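(* Let $d\in\mathbb{N}$, $d\ge2$, and $1/2\le s\le1$. For $n\ge2$ put $\alpha(n,d):=2+\log_2\big(\frac{d}{\log_2 n}+\frac12\big)$. Then for any $n\in\mathbb{N}$ with $2\le n\le\frac d2 4^d$ the two-sided estimate $$2^{-s}\Big(\frac1n\Big)^{\frac{s}{\alpha(n,d)}}\le a_n(I_d:H^{s,*}_{\rm mix}(\mathbb{T}^d)\to L_2(\mathbb{T}^d))\le\Big(\frac{e^2}{n}\Big)^{\frac{s}{4+\log_2(d^2)}}$$ holds.
   Context: $\mathbb{N}=\{1,2,3,\dots\}$. $\mathbb{T}^d$ is the $d$-torus, represented by $[0,2\pi]^d$ with opposite sides identified. $L_2(\mathbb{T}^d)$ carries the norm $\|f|L_2(\mathbb{T}^d)\|=(\int_{\mathbb{T}^d}|f(x)|^2dx)^{1/2}$, and for $f\in L_2(\mathbb{T}^d)$ the Fourier coefficients are $c_k(f)=(2\pi)^{-d/2}\int_{\mathbb{T}^d}f(x)e^{-ikx}dx$, $k\in\mathbb{Z}^d$ (so $\|f|L_2(\mathbb{T}^d)\|^2=\sum_k|c_k(f)|^2$). For $s>0$, $H^{s,*}_{\rm mix}(\mathbb{T}^d)$ is the space of all $f\in L_2(\mathbb{T}^d)$ for which the norm $$\|f|H^s_{\rm mix}(\mathbb{T}^d)\|^{*}=\Big[\sum_{k\in\mathbb{Z}^d}|c_k(f)|^2\prod_{j=1}^d(1+|k_j|^{2s})\Big]^{1/2}$$ is finite, equipped with this norm. $I_d$ denotes the identical embedding $f\mapsto f$. The approximation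 numbers of a bounded linear operator $T:X\to Y$ between Banach spaces are $a_n(T:X\to Y)=\inf\{\|T-A:X\to Y\| : A:X\to Y \text{ bounded linear},\ {\rm rank}\,A<n\}$, $n\in\mathbb{N}$. *)

(* Defs.v *)
From HB Require Import structures.
From mathcomp Require Import all_boot all_order all_algebra.
From mathcomp Require Import all_classical all_reals all_analysis.
From mathcomp.real_closed Require Import complex.
From mathcomp Require Import measurable_realfun ring.

Set Implicit Arguments.
Unset Strict Implicit.
Unset Printing Implicit Defensive.

Import Order.TTheory GRing.Theory Num.Theory numFieldNormedType.Exports.

Local Open Scope classical_set_scope.
Local Open Scope ring_scope.
Local Open Scope complex_scope.
Local Open Scope quotient_scope.

Notation cRe := complex.Re.
Notation cIm := complex.Im.
Notation normc := ComplexField.Normc.normc.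

Section complex_modulus.
Context {R : realType}.
Implicit Types z w : R[i].

Lemma normc_sqr z : normc z ^+ 2 = cRe z ^+ 2 + cIm z ^+ 2.
Proof. by case: z => a b /=; rewrite sqr_sqrtr// addr_ge0// sqr_ge0. Qed.

Lemma normcD_sqr z w :
  normc (z + w) ^+ 2 <= 2 * normc z ^+ 2 + 2 * normc w ^+ 2.
Proof.
rewrite !normc_sqr; case: z w => [a b] [c d] /=.
have h (x y : R) : (x + y) ^+ 2 <= 2 * x ^+ 2 + 2 * y ^+ 2.
  rewrite -subr_ge0.
  have -> : 2 * x ^+ 2 + 2 * y ^+ 2 - (x + y) ^+ 2 = (x - y) ^+ 2.
    by ring.
  exact: sqr_ge0.
by rewrite !mulrDr addrACA lerD.
Qed.

End complex_modulus.

(* A complex function is measurable when its real and imaginary parts are.    *)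
(* The elements of L2 are the classes of square-integrable functions modulo   *)
(* equality mu-almost everywhere; see L2_eqP.                                 *)
Section L2.
Context d (T : measurableType d) (R : realType) (mu : {measure set T -> \bar R}).
Implicit Types f g : T -> R[i].

Definition measurable_cfun f :=
  measurable_fun setT (fun x => cRe (f x)) /\
  measurable_fun setT (fun x => cIm (f x)).

Definition sqr_integrable f :=
  measurable_cfun f /\ (\int[mu]_x (normc (f x) ^+ 2)%:E < +oo)%E.

Lemma measurable_cRe f : measurable_cfun f ->
  measurable_fun setT (fun x => (cRe (f x) ^+ 2)%:E : \bar R).
Proof. by case=> mf _; apply/measurable_EFinP; exact: measurable_funX. Qed.

Lemma measurable_cIm f : measurable_cfun f ->
  measurable_fun setT (fun x => (cIm (f x) ^+ 2)%:E : \bar R).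
Proof. by case=> _ mf; apply/measurable_EFinP; exact: measurable_funX. Qed.

Lemma integral_normc_sqr f : measurable_cfun f ->
  (\int[mu]_x (normc (f x) ^+ 2)%:E =
   \int[mu]_x (cRe (f x) ^+ 2)%:E + \int[mu]_x (cIm (f x) ^+ 2)%:E)%E.
Proof.
move=> mf; under eq_integral do rewrite normc_sqr EFinD.
rewrite ge0_integralD//.
- by move=> x _; rewrite lee_fin sqr_ge0.
- exact: measurable_cRe.
- by move=> x _; rewrite lee_fin sqr_ge0.
- exact: measurable_cIm.
Qed.

Lemma Lfun2P (h : T -> R) : measurable_fun setT h ->
  (h \in Lfun mu 2%:E) <-> (\int[mu]_x (h x ^+ 2)%:E < +oo)%E.
Proof.
move=> mh; split.
  move/Lfun2_integrable_sqr/integrableP => [_]; apply: le_lt_trans.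
  by rewrite le_eqVlt; apply/orP; left; apply/eqP/eq_integral => x _ /=;
     rewrite ger0_norm// sqr_ge0.
move=> fin; rewrite inE; apply/andP; split; rewrite inE//=.
rewrite /finite_norm unlock poweR_lty//.
by under eq_integral do rewrite /= powR_mulrn// real_normK ?num_real//.
Qed.

Lemma sqr_integrableP f : sqr_integrable f <->
  (fun x => cRe (f x)) \in Lfun mu 2%:E /\ (fun x => cIm (f x)) \in Lfun mu 2%:E.
Proof.
split=> [[mf]|[fr fi]].
  have p0 (h : T -> R) : (0 <= \int[mu]_x (h x ^+ 2)%:E)%E.
    by apply: integral_ge0 => x _; rewrite lee_fin sqr_ge0.
  rewrite integral_normc_sqr// -ge0_fin_numE; last first.
    by rewrite adde_ge0 ?(p0 (cRe \o f)) ?(p0 (cIm \o f)).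
  rewrite fin_numD !ge0_fin_numE ?(p0 (cRe \o f)) ?(p0 (cIm \o f))//.
  by move=> /andP[rf jf]; split; apply/Lfun2P => //; [exact: mf.1|exact: mf.2].
have mf : measurable_cfun f.
  by split; [move: fr|move: fi]; rewrite inE => /andP[/[!inE]].
split=> //; rewrite integral_normc_sqr// lte_add_pinfty//.
  by apply/Lfun2P => //; exact: mf.1.
by apply/Lfun2P => //; exact: mf.2.
Qed.

Definition L2fun_pred : {pred T -> R[i]} := mem [set f | sqr_integrable f].

Lemma Lfun2_linear (a b : R) (g h : T -> R) : g \in Lfun mu 2%:E ->
  h \in Lfun mu 2%:E -> (fun x => a * g x + b * h x) \in Lfun mu 2%:E.
Proof.
have [z l] := Lfun_submod_closed mu (lee1n 2 : (1%:E <= 2%:R%:E :> \bar R)%E).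
move=> gL hL; have := l b h 0 hL z; rewrite addr0 => bh.
exact: l a g _ gL bh.
Qed.

Lemma L2fun_submod_closed : submod_closed L2fun_pred.
Proof.
split.
  rewrite inE; apply/sqr_integrableP.
  have [z _] := Lfun_submod_closed mu (lee1n 2 : (1%:E <= 2%:R%:E :> \bar R)%E).
  by split; exact: z.
move=> a f g; rewrite !inE => /sqr_integrableP[fr fi] /sqr_integrableP[gr gi].
apply/sqr_integrableP; split.
  rewrite (_ : (fun x => _) = (fun x => 1 * (cRe a * cRe (f x)
     + - cIm a * cIm (f x)) + 1 * cRe (g x))).
    by do 2?apply: Lfun2_linear.
  apply/funext => x; rewrite -[(a *: f + g) x]/(a * f x + g x).
  by case: a (f x) (g x) => [? ?] [? ?] [? ?] /=; ring.
rewrite (_ : (fun x => _) = (fun x => 1 * (cRe a * cIm (f x)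
     + cIm a * cRe (f x)) + 1 * cIm (g x))).
  by do 2?apply: Lfun2_linear.
apply/funext => x; rewrite -[(a *: f + g) x]/(a * f x + g x).
  by case: a (f x) (g x) => [? ?] [? ?] [? ?] /=; ring.
Qed.

HB.instance Definition _ :=
  GRing.isSubmodClosed.Build _ _ L2fun_pred L2fun_submod_closed.

Record L2fun := MkL2fun { L2fun_val :> T -> R[i]; _ : L2fun_val \in L2fun_pred }.

HB.instance Definition _ := [isSub for L2fun_val].
HB.instance Definition _ := [Choice of L2fun by <:].
HB.instance Definition _ := [SubChoice_isSubLmodule of L2fun by <:].

Lemma L2funP (u : L2fun) : sqr_integrable u.
Proof. by have := valP u; rewrite inE. Qed.

Definition ae_null : {pred L2fun} :=
  mem [set u : L2fun | {ae mu, forall x, u x = 0}].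

Lemma L2funE (a : R[i]) (u v : L2fun) x : (a *: u + v) x = a * u x + v x.
Proof. by []. Qed.

Lemma L2funZE (a : R[i]) (u : L2fun) x : (a *: u) x = a * u x.
Proof. by []. Qed.

Lemma L2funBE (u v : L2fun) x : (u - v) x = u x - v x.
Proof. by []. Qed.

Lemma ae_null_submod_closed : submod_closed ae_null.
Proof.
split; first by rewrite inE; exact: nearW.
move=> a u v; rewrite !inE => u0 v0.
by apply: filterS2 u0 v0 => x u0 v0; rewrite (L2funE a u v) u0 v0 mulr0 addr0.
Qed.

HB.instance Definition _ :=
  GRing.isSubmodClosed.Build _ _ ae_null ae_null_submod_closed.

Definition L2 : Type := Quotient.quot ae_null.

HB.instance Definition _ := EqQuotient.on L2.
HB.instance Definition _ := GRing.Zmodule.on L2.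

Lemma L2_eqP (u v : L2fun) :
  (\pi_L2 u = \pi_L2 v) <-> {ae mu, forall x, u x = v x}.
Proof.
split=> [/eqP|uv].
  rewrite -Quotient.idealrBE inE; apply: filterS => x.
  by rewrite (L2funBE u v) => /eqP; rewrite subr_eq0 => /eqP.
apply/eqP; rewrite -Quotient.idealrBE inE; apply: filterS uv => x uv.
by rewrite (L2funBE u v) uv subrr.
Qed.

Lemma L2_repr (u : L2fun) : {ae mu, forall x, repr (\pi_L2 u) x = u x}.
Proof. by apply/L2_eqP; rewrite reprK. Qed.

Definition L2_scale (a : R[i]) (f : L2) : L2 := \pi_L2 (a *: repr f).

Lemma L2_piZ a (u : L2fun) : \pi_L2 (a *: u) = L2_scale a (\pi_L2 u).
Proof.
apply/L2_eqP; apply: filterS (L2_repr u) => x ux.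
by rewrite !L2funZE ux.
Qed.

Lemma L2_piD (u v : L2fun) : \pi_L2 (u + v) = \pi_L2 u + \pi_L2 v.
Proof. exact: Quotient.pi_add. Qed.

Let L2_scaleA a b (f : L2) : L2_scale a (L2_scale b f) = L2_scale (a * b) f.
Proof. by rewrite -[f]reprK -(L2_piZ b) -!L2_piZ scalerA. Qed.

Let L2_scale1 : left_id 1 L2_scale.
Proof. by move=> f; rewrite -[f in LHS]reprK -L2_piZ scale1r reprK. Qed.

Let L2_scaleDr : right_distributive L2_scale +%R.
Proof.
by move=> a f g; rewrite -[f]reprK -[g]reprK -L2_piD -!L2_piZ scalerDr L2_piD.
Qed.

Let L2_scaleDl (f : L2) : {morph L2_scale^~ f : a b / a + b}.
Proof. by move=> a b; rewrite -[f]reprK -!L2_piZ scalerDl L2_piD. Qed.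

HB.instance Definition _ := GRing.Zmodule_isLmodule.Build R[i] L2
  L2_scaleA L2_scale1 L2_scaleDr L2_scaleDl.

Definition L2_norm (f : L2) : R :=
  Num.sqrt (fine (\int[mu]_x (normc (repr f x) ^+ 2)%:E)).

Lemma measurable_normc_sqr f : measurable_cfun f ->
  measurable_fun setT (fun x => (normc (f x) ^+ 2)%:E : \bar R).
Proof.
move=> mf; apply/measurable_EFinP.
rewrite (_ : (fun x => _) = (fun x => cRe (f x) ^+ 2 + cIm (f x) ^+ 2)).
  by apply: measurable_funD; apply: measurable_funX; [exact: mf.1|exact: mf.2].
by apply/funext => x; rewrite normc_sqr.
Qed.

Lemma L2_norm_pi (u : L2fun) :
  L2_norm (\pi_L2 u) = Num.sqrt (fine (\int[mu]_x (normc (u x) ^+ 2)%:E)).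
Proof.
congr (Num.sqrt (fine _)); apply: ge0_ae_eq_integral => //.
- exact: measurable_normc_sqr (L2funP _).1.
- exact: measurable_normc_sqr (L2funP _).1.
- by move=> x _; rewrite lee_fin sqr_ge0.
- by move=> x _; rewrite lee_fin sqr_ge0.
- by apply: filterS (L2_repr u) => x ->.
Qed.

End L2.

(* The norms of X and Y are explicit arguments, so that a subspace can carry a *)
(* norm of its own.  Values are in \bar R: an unbounded operator has norm +oo, *)
(* and the infimum of the empty set (the case n = 0) is +oo.                   *)
Section approximation_numbers.
Context {R : realType} {X Y : lmodType R[i]}.
Variables (nX : X -> R) (nY : Y -> R).

Definition op_norm (T : X -> Y) : \bar R :=
  ereal_sup [set (nY (T x))%:E | x in [set x | nX x <= 1]].

Definition rank_lt (n : nat) (A : X -> Y) : Prop :=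
  exists2 m, (m < n)%N & exists y : 'I_m -> Y,
    forall x, exists c : 'I_m -> R[i], A x = \sum_(i < m) c i *: y i.

Definition approximation_number (n : nat) (T : X -> Y) : \bar R :=
  ereal_inf [set op_norm (fun x => T x - A x) | A in
    [set A : {linear X -> Y} | (op_norm A < +oo)%E /\ rank_lt n A]].

End approximation_numbers.

(* Functions on the torus are represented by functions on R^d, considered      *)
(* up to null sets of torus_measure d, the Lebesgue measure of [0, 2 pi]^d     *)
(* (see torus_measure_box): values outside the cube and the identification of  *)
(* its opposite sides play no role.                                            *)
Section torus.
Context {R : realType}.

Definition circle_measure : set (measurableTypeR R) -> \bar R :=
  mrestr lebesgue_measure (measurable_itv `[0, 2 * pi]).

HB.instance Definition _ := Measure.on circle_measure.

Let circle_measure_fin : fin_num_fun circle_measure.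
Proof.
apply: lty_fin_num_fun.
apply: (@le_lt_trans _ _ (lebesgue_measure `[0%R, (2 * pi)%R]%classic)).
  by apply: le_measure; rewrite ?inE//; exact: measurableI.
by rewrite lebesgue_measure_itv; case: ifPn; rewrite /= ?ltry.
Qed.

HB.instance Definition _ :=
  Measure_isFinite.Build _ _ _ circle_measure circle_measure_fin.

Definition consm (n : nat) (p : measurableTypeR R * n.-tuple (measurableTypeR R)) :
  n.+1.-tuple (measurableTypeR R) := [tuple of p.1 :: p.2].

Lemma measurable_consm n : measurable_fun setT (@consm n).
Proof. exact: measurable_cons. Qed.

HB.instance Definition _ n :=
  isMeasurableFun.Build _ _ _ _ (@consm n) (@measurable_consm n).

Section cons_measure.
Variables (n : nat)
  (nu : {finite_measure set (n.-tuple (measurableTypeR R)) -> \bar R}).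

Definition cons_measure : set (n.+1.-tuple (measurableTypeR R)) -> \bar R :=
  pushforward (circle_measure \x nu)%E (@consm n).

HB.instance Definition _ := Measure.copy cons_measure
  (measure_function_pushforward__canonical__measure_function_Measure
    (circle_measure \x nu)%E (@measurable_consm n)).

Let cons_measure_fin : fin_num_fun cons_measure.
Proof.
apply: lty_fin_num_fun.
suff : ((circle_measure \x nu)%E (setT `*` setT) < +oo)%E by rewrite setXTT.
rewrite product_measure1E// ltey_eq fin_numM//; exact: fin_num_measure.
Qed.

HB.instance Definition _ :=
  Measure_isFinite.Build _ _ _ cons_measure cons_measure_fin.

End cons_measure.

Fixpoint torus_measure (d : nat) :
    {finite_measure set (d.-tuple (measurableTypeR R)) -> \bar R} :=
  match d with
  | 0 => \d_([tuple] : 0.-tuple (measurableTypeR R))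
  | n.+1 => cons_measure (torus_measure n)
  end.

Lemma measurable_box d (A : 'I_d -> set (measurableTypeR R)) :
  (forall i, measurable (A i)) ->
  measurable [set x : d.-tuple (measurableTypeR R) | forall i, A i (tnth x i)].
Proof.
move=> mA.
have -> : [set x : d.-tuple (measurableTypeR R) | forall i, A i (tnth x i)] =
    \bigcap_(i in [set: 'I_d]) ((fun x => tnth x i) @^-1` A i).
  by apply/seteqP; split=> x /= h i; [move=> _; exact: h|exact: h].
apply: fin_bigcap_measurable => [|i _]; first exact: finite_finset.
by have := @measurable_tnth _ (measurableTypeR R) d i measurableT _ (mA i); rewrite setTI.
Qed.

Lemma torus_measure_box d (A : 'I_d -> set (measurableTypeR R)) :
  (forall i, measurable (A i)) ->
  torus_measure d [set x | forall i, A i (tnth x i)] =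
  (\prod_(i < d) lebesgue_measure (A i `&` `[0%R, (2 * pi)%R]%classic))%E.
Proof.
elim: d A => [|d IH] A mA.
  rewrite big_ord0 /= diracE mem_set//=; by case.
rewrite big_ord_recl -IH//.
rewrite -[lebesgue_measure _]/(circle_measure (A ord0)).
rewrite -product_measure1E//; last first.
  exact: (@measurable_box d (fun i => A (lift ord0 i)) (fun i => mA _)).
rewrite [LHS]/= /cons_measure /pushforward.
congr (product_measure1 _ _ _); apply/seteqP; split=> -[x t] /=.
  by move=> h; split=> [|i]; [exact: (h ord0)|have := h (lift ord0 i); rewrite tnthS].
move=> [h0 h] i; case: (unliftP ord0 i) => [j ->|->]; last exact: h0.
by rewrite tnthS; exact: h.
Qed.

End torus.

Section complex_integral.
Context d (T : measurableType d) (R : realType) (mu : {measure set T -> \bar R}).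
Implicit Types f g : T -> R[i].

Definition cintegral f : R[i] :=
  Rintegral mu setT (fun x => cRe (f x)) +i* Rintegral mu setT (fun x => cIm (f x)).

Definition cintegrable f :=
  mu.-integrable setT (EFin \o (fun x => cRe (f x))) /\
  mu.-integrable setT (EFin \o (fun x => cIm (f x))).

Lemma Rintegral_linear (a b : R) (g h : T -> R) :
  mu.-integrable setT (EFin \o g) -> mu.-integrable setT (EFin \o h) ->
  mu.-integrable setT (EFin \o (fun x => a * g x + b * h x)) /\
  Rintegral mu setT (fun x => a * g x + b * h x) =
    a * Rintegral mu setT g + b * Rintegral mu setT h.
Proof.
move=> ig ih.
have ag : mu.-integrable setT (EFin \o (fun x => a * g x)).
  have := integrableZl measurableT a ig; apply: eq_integrable => // x _.
have bh : mu.-integrable setT (EFin \o (fun x => b * h x)).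
  have := integrableZl measurableT b ih; apply: eq_integrable => // x _.
split; last by rewrite RintegralD// !RintegralZl.
have := integrableD measurableT ag bh; apply: eq_integrable => // x _.
Qed.

Lemma cintegral_linear (a : R[i]) f g : cintegrable f -> cintegrable g ->
  cintegral (fun x => a * f x + g x) = a * cintegral f + cintegral g.
Proof.
move=> [fr fi] [gr gi]; rewrite /cintegral.
have -> : (fun x => cRe (a * f x + g x)) =
    (fun x => 1 * (cRe a * cRe (f x) + - cIm a * cIm (f x)) + 1 * cRe (g x)).
  by apply/funext => x; case: a (f x) (g x) => [? ?] [? ?] [? ?] /=; ring.
have -> : (fun x => cIm (a * f x + g x)) =
    (fun x => 1 * (cRe a * cIm (f x) + cIm a * cRe (f x)) + 1 * cIm (g x)).
  by apply/funext => x; case: a (f x) (g x) => [? ?] [? ?] [? ?] /=; ring.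
have [i1 e1] := Rintegral_linear (cRe a) (- cIm a) fr fi.
have [i2 e2] := Rintegral_linear (cRe a) (cIm a) fi fr.
rewrite (Rintegral_linear 1 1 i1 gr).2 (Rintegral_linear 1 1 i2 gi).2 e1 e2.
by case: a {i1 i2 e1 e2} => u v; apply/eqP; rewrite eq_complex /=;
  apply/andP; split; apply/eqP; ring.
Qed.

Lemma ae_eq_cintegral f g : measurable_cfun f -> measurable_cfun g ->
  {ae mu, forall x, f x = g x} -> cintegral f = cintegral g.
Proof.
move=> [fr fi] [gr gi] fg; rewrite /cintegral /Rintegral; congr (_ +i* _).
  congr fine; apply: ae_eq_integral => //; try exact/measurable_EFinP.
  by apply: filterS fg => x -> _.
congr fine; apply: ae_eq_integral => //; try exact/measurable_EFinP.
by apply: filterS fg => x -> _.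
Qed.

Lemma Lfun2_mul_integrable (g h : T -> R) :
  g \in Lfun mu 2%:E -> h \in Lfun mu 2%:E ->
  mu.-integrable setT (EFin \o (fun x => g x * h x)).
Proof. by move=> gL hL; apply/Lfun1_integrable; exact: Lfun2_mul_Lfun1. Qed.

Lemma cintegrable_mul f g : sqr_integrable mu f -> sqr_integrable mu g ->
  cintegrable (fun x => f x * g x).
Proof.
move=> /sqr_integrableP[fr fi] /sqr_integrableP[gr gi]; split.
  have [+ _] := Rintegral_linear 1 (-1) (Lfun2_mul_integrable fr gr)
    (Lfun2_mul_integrable fi gi).
  apply: eq_integrable => // x _ /=; congr EFin.
  by case: (f x) (g x) => [? ?] [? ?] /=; ring.
have [+ _] := Rintegral_linear 1 1 (Lfun2_mul_integrable fr gi)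
  (Lfun2_mul_integrable fi gr).
apply: eq_integrable => // x _ /=; congr EFin.
by case: (f x) (g x) => [? ?] [? ?] /=; ring.
Qed.

Lemma measurable_cfunM f g : measurable_cfun f -> measurable_cfun g ->
  measurable_cfun (fun x => f x * g x).
Proof.
move=> [fr fi] [gr gi]; split.
  rewrite (_ : (fun x => _) =
    (fun x => cRe (f x) * cRe (g x) - cIm (f x) * cIm (g x))).
    by apply: measurable_funB; exact: measurable_funM.
  by apply/funext => x; case: (f x) (g x) => [? ?] [? ?].
rewrite (_ : (fun x => _) =
  (fun x => cRe (f x) * cIm (g x) + cIm (f x) * cRe (g x))).
  by apply: measurable_funD; exact: measurable_funM.
by apply/funext => x; case: (f x) (g x) => [? ?] [? ?].
Qed.

End complex_integral.

Section Fourier.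
Context {R : realType} {d : nat}.
Notation torus := (d.-tuple (measurableTypeR R)).
Notation mu := (@torus_measure R d).
Notation L2T := (L2 mu).
Implicit Types (k : d.-tuple int).

Definition expi (t : R) : R[i] := cos t +i* sin t.

Definition dotZ k (x : torus) : R := \sum_(j < d) (tnth k j)%:~R * tnth x j.

Lemma measurable_dotZ k : measurable_fun setT (dotZ k).
Proof.
apply: measurable_sum => j; apply: measurable_funM => //.
exact: measurable_tnth.
Qed.

Definition fourier_fun k (f : torus -> R[i]) : R[i] :=
  ((2 * pi) `^ (- (d%:R / 2)))%:C *
  cintegral mu (fun x => f x * expi (- dotZ k x)).

Definition fourier_coef k (f : L2T) : R[i] := fourier_fun k (repr f).

Lemma sqr_integrable_expi k : sqr_integrable mu (fun x => expi (- dotZ k x)).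
Proof.
have mN : measurable_fun setT (fun x : torus => - dotZ k x).
  by apply: measurableT_comp => //; exact: measurable_dotZ.
split; first split=> /=.
- apply: measurableT_comp mN; apply: continuous_measurable_fun; exact: continuous_cos.
- apply: measurableT_comp mN; apply: continuous_measurable_fun; exact: continuous_sin.
under eq_integral do rewrite normc_sqr /= cos2Dsin2.
rewrite integral_cst// mul1e.
by apply: fin_num_fun_lty; exact: fin_num_measure.
Qed.

Lemma fourier_coef_pi k (u : L2fun mu) :
  fourier_coef k (\pi_(L2T) u) = fourier_fun k u.
Proof.
congr (_ * _); apply: ae_eq_cintegral.
- by apply: measurable_cfunM; [exact: (L2funP _).1|exact: (sqr_integrable_expi k).1].
- by apply: measurable_cfunM; [exact: (L2funP _).1|exact: (sqr_integrable_expi k).1].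
- by apply: filterS (L2_repr u) => x ->.
Qed.

Lemma fourier_coef_linear k a (f g : L2T) :
  fourier_coef k (a *: f + g) = a * fourier_coef k f + fourier_coef k g.
Proof.
rewrite -[in LHS](reprK f) -[in LHS](reprK g) -[a *: _]L2_piZ -L2_piD fourier_coef_pi.
rewrite /fourier_coef /fourier_fun mulrCA -mulrDr -cintegral_linear; first last.
- by apply: cintegrable_mul; [exact: L2funP|exact: sqr_integrable_expi].
- by apply: cintegrable_mul; [exact: L2funP|exact: sqr_integrable_expi].
by congr (_ * cintegral _ _); apply/funext => x; rewrite L2funE mulrDl mulrA.
Qed.

Lemma esumZ_le (b : R) (I : choiceType) (a : I -> \bar R) : 0 <= b ->
  (forall i, (0 <= a i)%E) ->
  (\esum_(i in setT) (b%:E * a i) <= b%:E * \esum_(i in setT) a i)%E.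
Proof.
move=> b0 a0; apply: ge_ereal_sup => _ [A fA <-].
rewrite -ge0_mule_fsumr// lee_wpmul2l//.
by apply: ereal_sup_ubound; exists A.
Qed.

(* For f : Hmix the sum Hmix_sum f is finite, so that fine in Hmix_norm loses  *)
(* no information.  In Hmix_weight, 0 `^ (2 * s) = 0 as soon as s != 0.        *)
Section mixed_smoothness.
Variable s : R.

Definition Hmix_weight k : R :=
  \prod_(j < d) (1 + (`|tnth k j|%N%:R) `^ (2 * s)).

Lemma Hmix_weight_ge0 k : 0 <= Hmix_weight k.
Proof. by apply: prodr_ge0 => j _; rewrite addr_ge0// powR_ge0. Qed.

Definition Hmix_sum (f : L2T) : \bar R :=
  \esum_(k in [set: d.-tuple int]) (normc (fourier_coef k f) ^+ 2 * Hmix_weight k)%:E.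

Definition Hmix_pred : {pred L2T} := mem [set f | (Hmix_sum f < +oo)%E].

Lemma Hmix_submod_closed : submod_closed Hmix_pred.
Proof.
have c0 k : fourier_coef k 0 = 0.
  by have := fourier_coef_linear k (-1) 0 0; rewrite scaler0 addr0 mulN1r addNr.
have p0 f k : (0 <= (normc (fourier_coef k f) ^+ 2 * Hmix_weight k)%:E)%E.
  by rewrite lee_fin mulr_ge0 ?sqr_ge0 ?Hmix_weight_ge0.
have q0 (b : R) f k : 0 <= b ->
    (0 <= b%:E * (normc (fourier_coef k f) ^+ 2 * Hmix_weight k)%:E)%E.
  by move=> b0; rewrite mule_ge0.
split.
  rewrite inE /=/Hmix_sum esum1// => k _.
  by rewrite c0 ComplexField.Normc.normc0 expr0n mul0r.
move=> a f g; rewrite !inE /= => Hf Hg.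
pose b := 2 * normc a ^+ 2.
have b0 : 0 <= b by rewrite mulr_ge0// sqr_ge0.
apply: (@le_lt_trans _ _ (b%:E * Hmix_sum f + 2%:E * Hmix_sum g)%E).
  apply: le_trans (leeD (esumZ_le b0 (p0 f)) (esumZ_le _ (p0 g))) => //.
  rewrite -esumD//; [|by move=> k _; exact: q0|by move=> k _; exact: q0].
  apply: le_esum => k _; rewrite -!EFinM -EFinD lee_fin (mulrA b) (mulrA 2) -mulrDl.
  rewrite ler_wpM2r ?Hmix_weight_ge0// fourier_coef_linear.
  apply: le_trans (normcD_sqr _ _) _.
  by rewrite ComplexField.Normc.normcM exprMn /b mulrA.
by rewrite lte_add_pinfty// lte_mul_pinfty// ?lee_fin// ?ltW.
Qed.

HB.instance Definition _ :=
  GRing.isSubmodClosed.Build _ _ Hmix_pred Hmix_submod_closed.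

Record Hmix := MkHmix { Hmix_val : L2T; _ : Hmix_val \in Hmix_pred }.

HB.instance Definition _ := [isSub for Hmix_val].
HB.instance Definition _ := [Choice of Hmix by <:].
HB.instance Definition _ := [SubChoice_isSubLmodule of Hmix by <:].

Definition Hmix_norm (f : Hmix) : R := Num.sqrt (fine (Hmix_sum (Hmix_val f))).

Definition Hmix_embedding : {linear Hmix -> L2T} := \val.

End mixed_smoothness.

End Fourier.

Arguments Hmix R d s : clear implicits.
Arguments Hmix_norm {R d} s f.
Arguments Hmix_embedding {R} d s.

Definition log2 {R : realType} (x : R) : R := ln x / ln 2.

Definition alpha {R : realType} (n d : nat) : R :=
  2 + log2 (d%:R / log2 n%:R + 2^-1).

(* Main.v *)
(* Exponentials are orthogonal in both spaces, so a_n is the n-th largest value of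
   w(k)^(-1/2), w(k) = prod_j (1 + |k_j|^(2s)), and one counts frequencies.

   Upper bound: A is the partial Fourier sum over {k : prod_j (1 + k_j^2) < r}
   with r = (n / e^2)^(1/p), p = 2 + log_2 d.  Since s <= 1, w(k) is at least
   (prod_j (1 + k_j^2))^s.  By Rankin's trick the number of these k is at most
   r^p (1 + 2 sum_m (1 + m^2)^(-p))^d <= r^p (1 + 1/d)^d <= e r^p < n, because
   2^(-p) = 1/(4d).  The error is controlled by Parseval's inequality, that is by
   the density of trigonometric polynomials in L_2.  Density: the bounded functions
   in the L_2-closure of an algebra of bounded functions form an algebra closed under
   bounded pointwise limits, so it contains the indicators of the sets {f > a}, and
   hence of the sigma-algebra that they generate.

   Lower bound: an operator of rank < n kills a trigonometric polynomial with n given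
   frequencies.  Since s >= 1/2, w(k) <= (prod_j (1 + |k_j|))^(2s), so one needs n
   frequencies with prod_j (1 + |k_j|) <= 2^u, where u is the integral part of
   1 + log_2(n) / alpha(n, d).  There are at least 2^u C(u + d - 1, u) of them.  If
   u <= d then n < (2 + 2d/u)^u; if u > d one uses n <= d 4^d / 2. *)

From HB Require Import structures.
Require Import Defs.
From mathcomp Require Import all_boot all_order all_algebra.
From mathcomp Require Import all_classical all_reals all_analysis.
From mathcomp.real_closed Require Import complex.
From mathcomp Require Import measurable_realfun ring lra zify.

Set Implicit Arguments.
Unset Strict Implicit.
Unset Printing Implicit Defensive.

Import Order.TTheory GRing.Theory Num.Theory numFieldNormedType.Exports.
Import HBNNSimple.
Local Open Scope classical_set_scope.
Local Open Scope ring_scope.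

(** * Density of an algebra of bounded functions *)

Section l2_closure.
Context dT (T : measurableType dT) (R : realType).
Variable mu : {finite_measure set T -> \bar R}.
Implicit Types (f g h : T -> R).

(** The square of the L_2 distance; leaving out the root costs a factor 2 in the triangle
    inequality. *)
Definition l2dist f g : \bar R := (\int[mu]_x ((f x - g x) ^+ 2)%:E)%E.

Lemma measurable_sqrB f g : measurable_fun setT f -> measurable_fun setT g ->
  measurable_fun setT (fun x => ((f x - g x) ^+ 2)%:E : \bar R).
Proof.
by move=> mf mg; apply/measurable_EFinP/measurable_funX; exact: measurable_funB.
Qed.

(** Integration of a pointwise bound. It serves as the triangle inequality for squared distances in
    all the closure properties below. *)
Lemma l2dist_le (A B : R) f g f1 g1 f2 g2 : 0 <= A -> 0 <= B ->
  measurable_fun setT f -> measurable_fun setT g ->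
  measurable_fun setT f1 -> measurable_fun setT g1 ->
  measurable_fun setT f2 -> measurable_fun setT g2 ->
  (forall x, (f x - g x) ^+ 2 <= A * (f1 x - g1 x) ^+ 2 + B * (f2 x - g2 x) ^+ 2) ->
  (l2dist f g <= A%:E * l2dist f1 g1 + B%:E * l2dist f2 g2)%E.
Proof.
move=> A0 B0 mf mg mf1 mg1 mf2 mg2 H.
have m1 := measurable_sqrB mf1 mg1; have m2 := measurable_sqrB mf2 mg2.
have p (C : R) (u v : T -> R) x : 0 <= C -> (0 <= C%:E * ((u x - v x) ^+ 2)%:E)%E.
  by move=> C0; rewrite mule_ge0// lee_fin// sqr_ge0.
have q (u v : T -> R) x : (0 <= ((u x - v x) ^+ 2)%:E)%E by rewrite lee_fin sqr_ge0.
rewrite /l2dist -!ge0_integralZl_EFin//; try by move=> ? _; exact: q.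
rewrite -ge0_integralD//; try by move=> ? _; exact: p.
- apply: ge0_le_integral => //.
  + exact: measurable_sqrB.
  + by apply: emeasurable_funD; exact: measurable_funeM.
  + by move=> x _; rewrite -!EFinM -EFinD lee_fin.
- exact: measurable_funeM.
- exact: measurable_funeM.
Qed.

Lemma sqrD_le2 (a b : R) : (a + b) ^+ 2 <= 2 * a ^+ 2 + 2 * b ^+ 2.
Proof. by rewrite -subr_ge0 (_ : _ - _ = (a - b) ^+ 2) ?sqr_ge0//; ring. Qed.

Lemma ler_sqr_norm (a b : R) : `|a| <= b -> a ^+ 2 <= b ^+ 2.
Proof.
by move=> ab; rewrite -real_normK ?num_real// ler_sqr ?nnegrE// (le_trans _ ab).
Qed.

(* Its iterates converge pointwise on [0, 1], with limit 0, 1/2, 1 below, at and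
   above 1/2; no exceptional null set has to be discarded. *)
Definition smoothstep (y : R) : R := 3 * y ^+ 2 - 2 * y ^+ 3.

Lemma iter_smoothstep_bound n y : 0 <= y <= 1 -> 0 <= iter n smoothstep y <= 1.
Proof.
move=> y01; elim: n => //= n /andP[]; rewrite /smoothstep.
set z := iter _ _ _ => z0 z1; apply/andP; split.
  rewrite (_ : _ - _ = z ^+ 2 * (3 - 2 * z)); last by ring.
  by rewrite mulr_ge0 ?sqr_ge0//; lra.
rewrite -subr_ge0 (_ : _ - _ = (1 - z) ^+ 2 * (1 + 2 * z)); last by ring.
by rewrite mulr_ge0 ?sqr_ge0//; lra.
Qed.

Lemma smoothstep_ge y : 1 / 2 <= y <= 1 -> y <= smoothstep y.
Proof.
move=> y12; rewrite -subr_ge0 /smoothstep.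
rewrite (_ : _ - _ = y * ((1 - y) * (2 * y - 1))); last by ring.
by rewrite !mulr_ge0//; lra.
Qed.

Lemma iter_smoothstepC n y : iter n smoothstep (1 - y) = 1 - iter n smoothstep y.
Proof. by elim: n => //= n ->; rewrite /smoothstep; ring. Qed.

(** The iterates increase and stay below 1, so they have a limit. It is a fixed point of
    [smoothstep]; the fixed points are 0, 1/2 and 1, and only 1 exceeds 1/2. *)
Lemma iter_smoothstep_cvg1 y : 1 / 2 < y <= 1 ->
  iter n smoothstep y @[n --> \oo] --> (1 : R).
Proof.
move=> /andP[y2 y1]; pose v n := iter n smoothstep y.
have vb n : y <= v n <= 1.
  elim: n => [|n /andP[]]; first by rewrite /v /= lexx y1.
  move=> h1 h2; have /andP[_ v1] : 0 <= v n.+1 <= 1.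
    by apply: iter_smoothstep_bound; lra.
  by rewrite v1 andbT; apply: (le_trans h1); apply: (@smoothstep_ge (v n)); lra.
have vnd : nondecreasing_seq v.
  apply/nondecreasing_seqP => n; have /andP[h1 h2] := vb n.
  by apply: (@smoothstep_ge (v n)); lra.
have /cvg_ex[l vl] : cvgn v.
  apply: nondecreasing_is_cvgn => //; exists 1 => _ [n _ <-].
  by case/andP: (vb n).
have ly : y <= l by apply: (cvgr_to_ge vl); apply: nearW => n; case/andP: (vb n).
have l1 : l <= 1 by apply: (cvgr_to_le vl); apply: nearW => n; case/andP: (vb n).
have vSl : smoothstep (v n) @[n --> \oo] --> smoothstep l.
  have v2 : v n ^+ 2 @[n --> \oo] --> l ^+ 2 by exact: (cvgM vl vl).
  have v3 : v n ^+ 3 @[n --> \oo] --> l ^+ 3 by exact: (cvgM vl v2).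
  by apply: cvgB; apply: cvgM => //; exact: cvg_cst.
have vSl' : [sequence v n.+1]_n @ \oo --> l by rewrite (cvg_shiftS v).
have : smoothstep l = l by apply: (cvg_unique _ vSl vSl').
move/eqP; rewrite -subr_eq0 /smoothstep.
rewrite (_ : _ - _ = l * ((1 - l) * (2 * l - 1))); last by ring.
rewrite !mulf_eq0 => /or3P[/eqP|/eqP|/eqP]; [lra| |lra].
by move/eqP; rewrite subr_eq0 => /eqP le1; move: vl; rewrite -le1.
Qed.

Lemma iter_smoothstep_cvg y : 0 <= y <= 1 ->
  iter n smoothstep y @[n --> \oo] -->
  (if 1 / 2 < y then 1 else if y < 1 / 2 then 0 else 1 / 2 : R).
Proof.
move=> /andP[y0 y1]; case: ifPn => [y2|y2].
  by apply: iter_smoothstep_cvg1; rewrite y2.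
case: ifPn => y3.
  have : 1 - iter n smoothstep (1 - y) @[n --> \oo] --> (1 - 1 : R).
    by apply: cvgB; [exact: cvg_cst|apply: iter_smoothstep_cvg1; lra].
  rewrite subrr; apply: cvg_trans; apply: near_eq_cvg; apply: nearW => n.
  by rewrite iter_smoothstepC; ring.
have -> : y = 1 / 2 by lra.
apply: cvg_near_cst; apply: nearW => n.
by elim: n => //= n ->; rewrite /smoothstep; field.
Qed.

Lemma l2dist_cvg (u : (T -> R)^nat) f (G : T -> R) :
  (forall n, measurable_fun setT (u n)) -> measurable_fun setT f ->
  (forall x, u n x @[n --> \oo] --> f x) ->
  mu.-integrable setT (EFin \o G) ->
  (forall n x, (f x - u n x) ^+ 2 <= G x) ->
  l2dist f (u n) @[n --> \oo] --> 0%E.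
Proof.
move=> mu_ mf uf iG uG.
have lim : {ae mu, forall x, setT x ->
    (fun n => ((f x - u n x) ^+ 2)%:E : \bar R) @ \oo --> cst 0%E x}.
  apply: aeW => x _; apply: cvg_EFin; first exact: nearW.
  have d0 : f x - u n x @[n --> \oo] --> (0 : R).
    by rewrite -(subrr (f x)); apply: cvgB; [exact: cvg_cst|exact: uf].
  have := cvgM d0 d0; rewrite mulr0; exact.
have dom : {ae mu, forall x n, setT x -> (`|((f x - u n x) ^+ 2)%:E| <= (EFin \o G) x)%E}.
  by apply: aeW => x n _ /=; rewrite lee_fin ger0_norm ?sqr_ge0.
have [_ _] := dominated_convergence measurableT (fun n => measurable_sqrB mf (mu_ n))
  (measurable_cst _) lim iG dom.
by rewrite integral0.
Qed.

Record bounded_algebra (P : set (T -> R)) : Prop := BoundedAlgebra {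
  bounded_algebra_cst : forall a : R, P (cst a) ;
  bounded_algebraD : forall f g, P f -> P g -> P (fun x => f x + g x) ;
  bounded_algebraM : forall f g, P f -> P g -> P (fun x => f x * g x) ;
  bounded_algebra_measurable : forall f, P f -> measurable_fun setT f ;
  bounded_algebra_bounded : forall f, P f -> exists M : R, forall x, `|f x| <= M }.

Variable P : set (T -> R).
Hypothesis algP : bounded_algebra P.

Let P1 := bounded_algebra_cst algP.
Let PD := bounded_algebraD algP.
Let PM := bounded_algebraM algP.
Let Pm := bounded_algebra_measurable algP.
Let Pb := bounded_algebra_bounded algP.

Definition l2cl f := measurable_fun setT f /\
  forall e : R, 0 < e -> exists2 p, P p & (l2dist f p <= e%:E)%E.

(** A product of two square-integrable functions need not be square-integrable, so stability under
    multiplication is stated for the bounded members of the closure. *)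
Definition bl2cl f := l2cl f /\ exists M : R, forall x, `|f x| <= M.

Lemma P_l2cl f : P f -> l2cl f.
Proof.
move=> Pf; split; first exact: Pm.
move=> e e0; exists f => //; rewrite /l2dist.
under eq_integral do rewrite subrr expr0n.
by rewrite integral0 lee_fin ltW.
Qed.

Lemma P_bl2cl f : P f -> bl2cl f.
Proof. by move=> Pf; split; [exact: P_l2cl|exact: Pb]. Qed.

Lemma l2clD f g : l2cl f -> l2cl g -> l2cl (fun x => f x + g x).
Proof.
move=> [mf cf] [mg cg]; split; first exact: measurable_funD.
(* The squared triangle inequality gives 2 (e/4) + 2 (e/4) = e. *)
move=> e e0; have e4 : 0 < e / 4 by rewrite divr_gt0.
have [p Pp fp] := cf _ e4; have [q Pq gq] := cg _ e4.
exists (fun x => p x + q x); first exact: PD.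
apply: (@le_trans _ _ (2%:E * l2dist f p + 2%:E * l2dist g q)%E).
  apply: l2dist_le => //; try exact: Pm.
  - exact: measurable_funD.
  - by apply: measurable_funD; exact: Pm.
  - by move=> x; rewrite opprD addrACA sqrD_le2.
apply: (@le_trans _ _ (2%:E * (e/4)%:E + 2%:E * (e/4)%:E)%E).
  by apply: leeD; rewrite lee_wpmul2l// lee_fin.
by rewrite -!EFinM -EFinD lee_fin; lra.
Qed.

(** From f g - p q = (f - p) g + p (g - q). The approximant p of f is chosen first; its bound K then
    fixes the precision required of q. Adding 1 to the squared bounds keeps the denominators
    positive. *)
Lemma bl2clM f g : bl2cl f -> bl2cl g -> bl2cl (fun x => f x * g x).
Proof.
move=> [[mf cf] [M fM]] [[mg cg] [N gN]]; split; last first.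
  by exists (M * N) => x; rewrite normrM ler_pM.
split; first exact: measurable_funM.
move=> e e0.
have N0 : 0 < 4 * (N ^+ 2 + 1) by have := sqr_ge0 N; lra.
have [p Pp fp] := cf (e / (4 * (N ^+ 2 + 1))) (divr_gt0 e0 N0).
have [K pK] := Pb Pp.
have K0 : 0 < 4 * (K ^+ 2 + 1) by have := sqr_ge0 K; lra.
have [q Pq gq] := cg (e / (4 * (K ^+ 2 + 1))) (divr_gt0 e0 K0).
exists (fun x => p x * q x); first exact: PM.
apply: (@le_trans _ _ ((2 * N ^+ 2)%:E * l2dist f p + (2 * K ^+ 2)%:E * l2dist g q)%E).
  apply: l2dist_le => //; try exact: Pm.
  - by rewrite mulr_ge0// sqr_ge0.
  - by rewrite mulr_ge0// sqr_ge0.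
  - exact: measurable_funM.
  - by apply: measurable_funM; exact: Pm.
  move=> x; rewrite (_ : f x * g x - p x * q x =
    (f x - p x) * g x + p x * (g x - q x)); last by ring.
  apply: le_trans (sqrD_le2 _ _) _; rewrite !exprMn.
  have := ler_wpM2l (sqr_ge0 (f x - p x)) (ler_sqr_norm (gN x)).
  have := ler_wpM2l (sqr_ge0 (g x - q x)) (ler_sqr_norm (pK x)).
  lra.
apply: (@le_trans _ _ ((2 * N ^+ 2)%:E * (e / (4 * (N ^+ 2 + 1)))%:E +
   (2 * K ^+ 2)%:E * (e / (4 * (K ^+ 2 + 1)))%:E)%E).
  by apply: leeD; rewrite lee_wpmul2l// lee_fin mulr_ge0// sqr_ge0.
rewrite -!EFinM -EFinD lee_fin.
have h (c : R) : 2 * c ^+ 2 * (e / (4 * (c ^+ 2 + 1))) <= e / 2.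
  have c0 := sqr_ge0 c; rewrite mulrA ler_pdivrMr; last by lra.
  by nra.
by have := h N; have := h K; lra.
Qed.

Lemma l2clZ (a : R) f : l2cl f -> l2cl (fun x => a * f x).
Proof.
move=> [mf cf]; split; first exact: measurable_funM.
move=> e e0; have a0 : 0 < a ^+ 2 + 1 by have := sqr_ge0 a; lra.
have [p Pp fp] := cf _ (divr_gt0 e0 a0).
exists (fun x => a * p x); first exact: (PM (P1 a) Pp).
apply: (@le_trans _ _ ((a ^+ 2)%:E * l2dist f p + 0%:E * l2dist f p)%E).
  apply: l2dist_le => //; try exact: Pm.
  - exact: sqr_ge0.
  - exact: measurable_funM.
  - by apply: measurable_funM => //; exact: Pm.
  - by move=> x; rewrite -mulrBr exprMn mul0r addr0.
rewrite mul0e adde0.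
apply: (@le_trans _ _ ((a ^+ 2)%:E * (e / (a ^+ 2 + 1))%:E)%E).
  by rewrite lee_wpmul2l// lee_fin sqr_ge0.
by rewrite -EFinM lee_fin mulrA ler_pdivrMr//; nra.
Qed.

Lemma l2cl_dominated (u : (T -> R)^nat) f (G : T -> R) :
  (forall n, l2cl (u n)) ->
  (forall x, u n x @[n --> \oo] --> f x) ->
  mu.-integrable setT (EFin \o G) ->
  (forall n x, (f x - u n x) ^+ 2 <= G x) -> l2cl f.
Proof.
move=> cu uf iG uG.
have mf : measurable_fun setT f.
  apply: (measurable_fun_cvg (h:=u)) => [n|x _].
    exact: (cu n).1.
  exact: uf.
split=> // e e0; have e4 : 0 < e / 4 by rewrite divr_gt0.
have lim := l2dist_cvg (fun n => (cu n).1) mf uf iG uG.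
have [n _ /(_ n (leqnn n)) fn] : \forall n \near \oo, (l2dist f (u n) < (e / 4)%:E)%E.
  suff /lim : nbhs (0%E : \bar R) [set y | (y < (e / 4)%:E)%E] by [].
  by apply: open_ereal_lt'; rewrite lte_fin.
have [p Pp pn] := (cu n).2 _ e4; exists p => //.
apply: (@le_trans _ _ (2%:E * l2dist f (u n) + 2%:E * l2dist (u n) p)%E).
  apply: l2dist_le => //; try exact: Pm; try exact: (cu n).1.
  by move=> x; rewrite (_ : f x - p x = (f x - u n x) + (u n x - p x)) ?sqrD_le2//; ring.
apply: (@le_trans _ _ (2%:E * (e/4)%:E + 2%:E * (e/4)%:E)%E).
  by apply: leeD; rewrite lee_wpmul2l// ltW.
by rewrite -!EFinM -EFinD lee_fin; lra.
Qed.

(** Since mu is finite, the constant (2 M)^2 is an integrable majorant of the squared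
    differences. *)
Lemma bl2cl_bounded (u : (T -> R)^nat) f (M : R) :
  (forall n, l2cl (u n)) -> (forall n x, `|u n x| <= M) ->
  (forall x, u n x @[n --> \oo] --> f x) -> bl2cl f.
Proof.
move=> cu uM uf; have fM x : `|f x| <= M.
  by apply: (cvgr_to_le (cvg_norm (uf x))); apply: nearW.
split; last by exists M.
apply: (@l2cl_dominated u f (cst ((M + M) ^+ 2)) cu uf).
  exact: finite_measure_integrable_cst.
move=> n x; rewrite -real_normK ?num_real// ler_sqr ?nnegrE//.
  by apply: le_trans (ler_normB _ _) _; rewrite lerD.
by rewrite addr_ge0// (le_trans _ (fM x)).
Qed.

Definition l2set : set (set T) := [set A | bl2cl (\1_A)].

Lemma bl2clD f g : bl2cl f -> bl2cl g -> bl2cl (fun x => f x + g x).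
Proof.
move=> [cf [M fM]] [cg [N gN]]; split; first exact: l2clD.
by exists (M + N) => x; apply: le_trans (ler_normD _ _) _; exact: lerD.
Qed.

Lemma bl2cl_cst a : bl2cl (cst a).
Proof. by apply: P_bl2cl. Qed.

Lemma bl2clZ a f : bl2cl f -> bl2cl (fun x => a * f x).
Proof. by move=> cf; apply: bl2clM => //; exact: bl2cl_cst. Qed.

Lemma l2setC A : l2set A -> l2set (~` A).
Proof.
move=> cA; have := bl2clD (bl2cl_cst 1) (bl2clZ (-1) cA).
rewrite /l2set /=; congr bl2cl; apply/funext => x.
by rewrite !indicE in_setC; case: (x \in A) => /=; ring.
Qed.

Lemma l2setI A B : l2set A -> l2set B -> l2set (A `&` B).
Proof.
move=> cA cB; have := bl2clM cA cB; rewrite /l2set /=; congr bl2cl.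
by apply/funext => x; rewrite !indicE in_setI -natrM mulnb.
Qed.

Lemma l2set0 : l2set set0.
Proof. by rewrite /l2set /= indic0; exact: bl2cl_cst. Qed.

Lemma l2setU A B : l2set A -> l2set B -> l2set (A `|` B).
Proof.
move=> cA cB; rewrite -[_ `|` _]setCK setCU.
by apply: l2setC; apply: l2setI; exact: l2setC.
Qed.

(** At each point the indicators of the finite partial unions are eventually constant, so they
    converge boundedly to the indicator of the union. *)
Lemma l2set_bigcup (F : (set T)^nat) : (forall n, l2set (F n)) -> l2set (\bigcup_n F n).
Proof.
move=> cF; pose u n : T -> R := \1_(\big[setU/set0]_(i < n) F i).
have cu n : l2set (\big[setU/set0]_(i < n) F i).
  elim: n => [|n IHn]; first by rewrite big_ord0; exact: l2set0.
  by rewrite big_ord_recr; exact: l2setU.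
apply: (@bl2cl_bounded u _ 1) => [n|n x|x].
- exact: (cu n).1.
- by rewrite /u indicE; case: (_ \in _); rewrite ?normr1 ?normr0.
- rewrite indicE; have [/set_mem[n _ Fnx]|xF] := boolP (x \in _).
    apply: cvg_near_cst; exists n.+1 => // m /= nm; rewrite /u indicE mem_set//.
    by rewrite -bigcup_mkord; exists n.
  apply: cvg_near_cst; apply: nearW => n; rewrite /u indicE memNset//.
  rewrite -bigcup_mkord => -[m _ Fmx]; move/negP: xF; apply.
  by rewrite inE; exists m.
Qed.

(** An affine map carries the values of f into [0, 1] and a to 1/2. The iterates of the polynomial
    [smoothstep] stay in the algebra and converge boundedly to a function with values 0, 1/2 and
    1. *)
Lemma l2set_gt f a : bl2cl f -> l2set [set x | a < f x].
Proof.
move=> bf; have [_ [M fM]] := bf.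
pose K := `|M| + `|a| + 1.
have K0 : 0 < K by rewrite /K; have := normr_ge0 M; have := normr_ge0 a; lra.
pose g x := 1 / 2 + (2 * K)^-1 * (f x + - a).
have bg : bl2cl g.
  by apply: bl2clD (bl2cl_cst _) _; apply: bl2clZ; apply: bl2clD => //; exact: bl2cl_cst.
have g01 x : 0 <= g x <= 1.
  have : `|f x - a| <= K.
    apply: (le_trans (ler_normB _ _)); have := fM x; have := ler_norm M.
    rewrite /K; move=> h1 h2; lra.
  rewrite ler_norml => /andP[h1 h2].
  have e : g x = 1 / 2 + (f x - a) / (2 * K) by rewrite /g [_^-1 * _]mulrC.
  have : - (1/2) <= (f x - a) / (2 * K) by rewrite ler_pdivlMr; lra.
  have : (f x - a) / (2 * K) <= 1/2 by rewrite ler_pdivrMr; lra.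
  by rewrite e; lra.
have bi n : bl2cl (fun x => iter n smoothstep (g x)).
  elim: n => // n IHn; have b2 := bl2clM IHn IHn.
  have := bl2clD (bl2clZ 3 b2) (bl2clZ (-2) (bl2clM IHn b2)); congr bl2cl.
  by apply/funext => x /=; rewrite /smoothstep; ring.
pose h x : R := if 1 / 2 < g x then 1 else if g x < 1 / 2 then 0 else 1 / 2.
have bh : bl2cl h.
  apply: (@bl2cl_bounded _ _ 1 (fun n => (bi n).1)) => [n x|x].
    by have := iter_smoothstep_bound n (g01 x); rewrite ler_norml; lra.
  exact: iter_smoothstep_cvg.
(* The polynomial h (2 h - 1) sends 0, 1/2, 1 to 0, 0, 1, which removes the level f = a. *)
have := bl2clM bh (bl2clD (bl2clZ 2 bh) (bl2cl_cst (-1))).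
rewrite /l2set /=; congr bl2cl; apply/funext => x; rewrite indicE /h /=.
have -> : (x \in [set x0 | a < f x0]) = (1 / 2 < g x).
  apply/idP/idP; rewrite inE /= /g.
    by move=> afx; rewrite ltrDl mulr_gt0 ?invr_gt0; lra.
  by rewrite ltrDl pmulr_rgt0 ?invr_gt0; lra.
by case: ifPn => _ /=; [ring|case: ifPn => _; field].
Qed.

Lemma l2cl_ae f g : l2cl f -> measurable_fun setT g ->
  {ae mu, forall x, f x = g x} -> l2cl g.
Proof.
move=> [mf cf] mg fg; split=> // e e0; have [p Pp fp] := cf e e0; exists p => //.
apply: le_trans fp; rewrite le_eqVlt; apply/orP; left; apply/eqP.
apply: ae_eq_integral => //; try (apply: measurable_sqrB => //; exact: Pm).
by apply: filterS fg => x -> _.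
Qed.

(** On the torus the half spaces t < x_j agree with conditions on cos x_j and sin x_j only almost
    everywhere; this lemma absorbs the difference. *)
Lemma l2set_ae A B : l2set A -> measurable B ->
  {ae mu, forall x, A x <-> B x} -> l2set B.
Proof.
move=> cA mB AB; split; last first.
  by exists 1 => x; rewrite indicE; case: (_ \in _); rewrite ?normr1 ?normr0.
apply: (l2cl_ae cA.1); first exact: measurable_indic.
apply: filterS AB => x ABx; rewrite !indicE.
by congr (nat_of_bool _)%:R; apply/idP/idP; rewrite !inE => /ABx.
Qed.

Lemma sigma_algebra_l2set : sigma_algebra setT l2set.
Proof.
split; first exact: l2set0.
  by move=> A cA; rewrite setTD; exact: l2setC.
exact: l2set_bigcup.
Qed.

(** From here on the algebra is assumed rich enough to reach every measurable set; for trigonometric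
    polynomials this is [l2set_torus]. *)
Hypothesis l2set_measurable : forall A, measurable A -> l2set A.

Lemma l2cl_sum I (r : seq I) (u : I -> T -> R) :
  (forall i, l2cl (u i)) -> l2cl (fun x => \sum_(i <- r) u i x).
Proof.
move=> cu; elim: r => [|i r IHr].
  by under eq_fun do rewrite big_nil; apply: P_l2cl; exact: P1.
by under eq_fun do rewrite big_cons; exact: l2clD.
Qed.

Lemma l2cl_nnsfun (f : {nnsfun T >-> R}) : l2cl f.
Proof.
have -> : (f : T -> R) =
    (fun x => \sum_(y <- finmap.enum_fset (fset_set (range f))) y * \1_(f @^-1` [set y]) x).
  by apply/funext => x; rewrite fimfunE fsbig_finite.
by apply: l2cl_sum => y; apply: l2clZ; apply: (l2set_measurable _).1.
Qed.

(** Simple functions u with 0 <= u <= f converge to f, and (f - u)^2 <= f^2 gives the integrable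
    majorant. *)
Lemma l2cl_ge0 f : measurable_fun setT f -> (forall x, 0 <= f x) ->
  (\int[mu]_x ((f x) ^+ 2)%:E < +oo)%E -> l2cl f.
Proof.
move=> mf f0 fi.
have mEf : measurable_fun setT (EFin \o f) by exact/measurable_EFinP.
pose u n := nnsfun_approx measurableT mEf n.
have uf x : u n x @[n --> \oo] --> f x.
  have := @cvg_nnsfun_approx _ _ _ _ measurableT _ mEf (fun x _ => f0 x) x I.
  by move/fine_cvg.
apply: (@l2cl_dominated u f (fun x => f x ^+ 2)) => //.
- by move=> n; exact: l2cl_nnsfun.
- apply/integrableP; split; first by apply/measurable_EFinP/measurable_funX.
  by under eq_integral do rewrite /= ger0_norm ?sqr_ge0//.
move=> n x; have u0 : 0 <= u n x by [].
have ux : u n x <= f x.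
  rewrite /u nnsfun_approxE -lee_fin.
  exact: (@le_approx _ _ _ setT (EFin \o f) n x (fun x _ => f0 x) I).
rewrite ler_sqr ?nnegrE; lra.
Qed.

Theorem l2cl_full f : measurable_fun setT f ->
  (\int[mu]_x ((f x) ^+ 2)%:E < +oo)%E -> l2cl f.
Proof.
move=> mf fi.
have h (g : T -> R) : measurable_fun setT g -> (forall x, 0 <= g x <= `|f x|) -> l2cl g.
  move=> mg gf; apply: l2cl_ge0 => // [x|]; first by case/andP: (gf x).
  apply: le_lt_trans fi; apply: ge0_le_integral => //.
  - by move=> x _; rewrite lee_fin sqr_ge0.
  - by apply/measurable_EFinP/measurable_funX.
  - by apply/measurable_EFinP/measurable_funX.
  - move=> x _; rewrite lee_fin -[f x ^+ 2]real_normK ?num_real//.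
    by case/andP: (gf x) => ? ?; rewrite ler_sqr ?nnegrE.
have hp : l2cl (f^\+).
  apply: h => [|x]; first exact: measurable_funrpos.
  by rewrite funrpos_ge0 /= -[`|f x|]/((Num.norm \o f) x) -funrposDneg lerDl funrneg_ge0.
have hn : l2cl (f^\-).
  apply: h => [|x]; first exact: measurable_funrneg.
  by rewrite funrneg_ge0 /= -[`|f x|]/((Num.norm \o f) x) -funrposDneg lerDr funrpos_ge0.
have := l2clD hp (l2clZ (-1) hn); congr l2cl.
by rewrite -[in RHS](funrposBneg f); apply/funext => x; rewrite mulN1r.
Qed.

End l2_closure.

(** * Trigonometric polynomials *)

Section trigonometric_density.
Local Open Scope complex_scope.
Context {R : realType} {d : nat}.
Notation torus := (d.-tuple (measurableTypeR R)).
Notation mu := (@torus_measure R d).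
Implicit Types (k l : d.-tuple int) (x : torus) (p q : torus -> R).

Lemma expiD (a b : R) : expi (a + b) = expi a * expi b.
Proof.
by rewrite /expi cosD sinD; apply/eqP; rewrite eq_complex /= eqxx /= addrC mulrC eqxx.
Qed.

Definition addZ k l : d.-tuple int := [tuple tnth k i + tnth l i | i < d].

Lemma dotZD k l x : dotZ (addZ k l) x = dotZ k x + dotZ l x.
Proof.
rewrite /dotZ -big_split /=; apply: eq_bigr => i _.
by rewrite tnth_mktuple intrD mulrDl.
Qed.

(** The list consists of pairs of a coefficient and a frequency. Frequencies may repeat, so that
    sums are concatenations and products are lists of all pairs. *)
Definition trigsum (s : seq (R[i] * d.-tuple int)) x : R[i] :=
  \sum_(t <- s) t.1 * expi (dotZ t.2 x).

Definition real_trig : set (torus -> R) := [set p : torus -> R | [/\ measurable_fun setT p,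
  exists M : R, forall x, `|p x| <= M & exists s, forall x, (p x)%:C = trigsum s x]].

Lemma trigsumM s t x : trigsum s x * trigsum t x =
  trigsum [seq (a.1 * b.1, addZ a.2 b.2) | a <- s, b <- t] x.
Proof.
rewrite /trigsum big_allpairs_dep /= mulr_suml; apply: eq_bigr => a _.
rewrite mulr_sumr; apply: eq_bigr => b _; rewrite dotZD expiD.
by rewrite mulrACA.
Qed.

Lemma bounded_algebra_real_trig : bounded_algebra real_trig.
Proof.
split.
- move=> a; split; [exact: measurable_cst|by exists (`|a|)|].
  exists [:: (a%:C, [tuple 0%Z | i < d])] => x.
  rewrite /trigsum big_seq1 /dotZ big1 => [|i _]; last by rewrite tnth_mktuple mul0r.
  by rewrite /expi cos0 sin0 [X in _ * X](_ : _ = 1) ?mulr1.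
- move=> p q [mp [M pM] [s ps]] [mq [N qN] [t qt]]; split.
  + exact: measurable_funD.
  + by exists (M + N) => x; apply: le_trans (ler_normD _ _) (lerD _ _).
  + by exists (s ++ t) => x; rewrite /trigsum big_cat /= rmorphD /= ps qt.
- move=> p q [mp [M pM] [s ps]] [mq [N qN] [t qt]]; split.
  + exact: measurable_funM.
  + by exists (M * N) => x; rewrite normrM ler_pM.
  + exists [seq (a.1 * b.1, addZ a.2 b.2) | a <- s, b <- t] => x.
    by rewrite -trigsumM rmorphM /= ps qt.
- by move=> p [].
- by move=> p [].
Qed.

Definition unitZ (j : 'I_d) (a : int) : d.-tuple int := [tuple if i == j then a else 0 | i < d].

Lemma dotZ_unitZ j a x : dotZ (unitZ j a) x = a%:~R * tnth x j.
Proof.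
rewrite /dotZ (bigD1 j)//= big1 => [|i /negPf ij]; last by rewrite tnth_mktuple ij mul0r.
by rewrite tnth_mktuple eqxx addr0.
Qed.

Lemma real_trig_cos j : real_trig (fun x => cos (tnth x j)).
Proof.
split.
- apply: measurableT_comp; last exact: measurable_tnth.
  by apply: continuous_measurable_fun; exact: continuous_cos.
- by exists 1 => x; rewrite ler_norml cos_geN1 cos_le1.
- exists [:: ((2^-1)%:C, unitZ j 1); ((2^-1)%:C, unitZ j (-1))] => x.
  rewrite /trigsum big_cons big_seq1 /= !dotZ_unitZ mul1r mulN1r /expi cosN sinN.
  by simpc; apply/eqP; rewrite eq_complex /=; apply/andP; split; apply/eqP; field.
Qed.

Lemma real_trig_sin j : real_trig (fun x => sin (tnth x j)).
Proof.
split.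
- apply: measurableT_comp; last exact: measurable_tnth.
  by apply: continuous_measurable_fun; exact: continuous_sin.
- by exists 1 => x; rewrite ler_norml sin_geN1 sin_le1.
- exists [:: (0 -i* 2^-1, unitZ j 1); (0 +i* 2^-1, unitZ j (-1))] => x.
  rewrite /trigsum big_cons big_seq1 /= !dotZ_unitZ mul1r mulN1r /expi cosN sinN.
  by simpc; apply/eqP; rewrite eq_complex /=; apply/andP; split; apply/eqP; field.
Qed.

(** The exceptional set is a box with one side of Lebesgue measure 0. *)
Lemma torus_measure_coord0 (j : 'I_d) (N : set R) :
  measurable N -> countable (N `&` `[0, 2 * pi]) ->
  {ae mu, forall x, ~ N (tnth x j)}.
Proof.
move=> mN cN; pose A i := if i == j then N else setT.
exists [set x : torus | forall i, A i (tnth x i)]; split.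
- by apply: measurable_box => i; rewrite /A; case: ifP.
- rewrite torus_measure_box => [|i]; last by rewrite /A; case: ifP.
  rewrite (bigD1 j)//= {1}/A eqxx [X in (X * _)%E]countable_lebesgue_measure0//.
  by rewrite mul0e.
- move=> x /= /contrapT Nx i; rewrite /A; case: eqP => // ->.
  exact: Nx.
Qed.

(** On the half circle where sin is positive, cos decreases, so for t <= pi the conditions 0 < sin y
    and cos t < cos y together say y < t. For t > pi the reflection z -> 2 pi - z reduces to this
    case. *)
Lemma itv_gt_cos_sin (t y : R) : 0 < y < 2 * pi -> 0 < t < 2 * pi -> y <> t ->
  (t < y) = (if t <= pi then ~~ ((0 < sin y) && (cos t < cos y))
             else (sin y < 0) && (cos t < cos y)).
Proof.
have reflect (z : R) : cos (2 * pi - z) = cos z /\ sin (2 * pi - z) = - sin z.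
  by rewrite mulr_natl cosB sinB cos2pi sin2pi !mul0r mul1r addr0 mul1r sub0r.
have h (z r : R) : 0 < z < 2 * pi -> 0 < r <= pi ->
    (0 < sin z) && (cos r < cos z) = (z < r).
  move=> z0 r0.
  have [zp|zp] := ltP z pi.
    by rewrite sin_gt0_pi ?ltr_cos ?in_itv //=; lra.
  have -> : (z < r) = false by apply/negbTE; rewrite -leNgt; lra.
  apply/negbTE/negP => /andP[sz _].
  have := @sin_ge0_pi _ (2 * pi - z); rewrite (reflect z).2.
  have z2 : 0 <= 2 * pi - z <= pi by lra.
  by move=> /(_ z2); lra.
move=> y0 t0 yt; case: ifPn => tp.
  by rewrite h//; [rewrite -leNgt le_eqVlt; case: eqP => // /esym|lra].
have [ct st] := reflect t; have [cy sy] := reflect y.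
rewrite -ct -cy -[sin y]opprK -sy oppr_lt0 h//; lra.
Qed.

(** Up to a null set this is everything for t <= 0, empty for t >= 2 pi, and otherwise a Boolean
    combination of superlevel sets of cos x_j and of sin x_j or - sin x_j. *)
Lemma l2set_tnth_gt j t : l2set mu real_trig [set x : torus | t < tnth x j].
Proof.
have algP := bounded_algebra_real_trig.
have mgt : measurable [set x : torus | t < tnth x j].
  have := @measurable_tnth _ (measurableTypeR R) d j measurableT _ (measurable_itv `]t, +oo[).
  rewrite setTI; congr measurable; apply/seteqP; split=> x /=; rewrite in_itv /= andbT//.
have bc := P_bl2cl mu algP (real_trig_cos j).
have bs := P_bl2cl mu algP (real_trig_sin j).
have bsN : bl2cl mu real_trig (fun x => -1 * sin (tnth x j)) by exact: bl2clZ.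
(* Discarded: the endpoints 0 and 2 pi, the outside of the cube, and the hyperplane x_j = t, where
   the trigonometric description fails. *)
have nul : {ae mu, forall x : torus, ~ (~` `]0, 2 * pi[ `|` [set t]) (tnth x j)}.
  apply: torus_measure_coord0.
    by apply: measurableU => //; apply: measurableC; exact: measurable_itv.
  apply: (@sub_countable _ _ _ [set 0; 2 * pi; t]).
    apply: subset_card_le => z /= [[]]; rewrite !in_itv /=.
      move=> /negP; rewrite negb_and -!leNgt => /orP[] h /andP[z0 z2].
        by left; left; apply/eqP; rewrite eq_le h z0.
      by left; right; apply/eqP; rewrite eq_le h z2.
    by move=> -> _; right.
  by apply: finite_set_countable.
have [t0|t0] := leP t 0.
  apply: (@l2set_ae _ _ _ _ _ algP setT) => //.
    rewrite /l2set /=; have := bl2cl_cst mu algP 1; congr bl2cl.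
    by apply/funext => x; rewrite indicE in_setT.
  apply: filterS nul => x /not_orP[/contrapT]; rewrite /= in_itv /= => h _; split=> // _.
  lra.
have [t2|t2] := leP (2 * pi) t.
  apply: (@l2set_ae _ _ _ _ _ algP set0) => //; first exact: l2set0.
  apply: filterS nul => x /not_orP[/contrapT]; rewrite /= in_itv /= => h _; split=> //=.
  lra.
have [tp|tp] := leP t pi.
  apply: (@l2set_ae _ _ _ _ _ algP
    (~` ([set x | 0 < sin (tnth x j)] `&` [set x | cos t < cos (tnth x j)]))) => //.
    by apply: l2setC => //; apply: l2setI => //; exact: l2set_gt.
  apply: filterS nul => x /not_orP[/contrapT]; rewrite /= in_itv /= => h xt.
  have t02 : 0 < t < 2 * pi by rewrite t0.
  rewrite (itv_gt_cos_sin h t02 xt) tp.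
  by split=> [hh|/negP hh]; [apply/negP => /andP|move=> /andP].
apply: (@l2set_ae _ _ _ _ _ algP
  ([set x | 0 < -1 * sin (tnth x j)] `&` [set x | cos t < cos (tnth x j)])) => //.
  by apply: l2setI => //; exact: l2set_gt.
apply: filterS nul => x /not_orP[/contrapT]; rewrite /= in_itv /= => h xt.
have t02 : 0 < t < 2 * pi by rewrite t0.
by rewrite (itv_gt_cos_sin h t02 xt) leNgt tp /= mulN1r oppr_gt0; split=> /andP.
Qed.

(** The sigma-algebra of the product is generated by the preimages of the rays ]t, +oo[ under the
    coordinates, and [l2set] is a sigma-algebra containing these. *)
Lemma l2set_torus (B : set torus) : measurable B -> l2set mu real_trig B.
Proof.
have algP := bounded_algebra_real_trig.
have sl := sigma_algebra_l2set mu algP.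
apply: (smallest_sub sl).
apply: (big_ind (fun X => X `<=` l2set mu real_trig)) => //.
  by move=> X Y hX hY A [|]; [exact: hX|exact: hY].
move=> j _ _ [C mC <-].
have si := sigma_algebra_image (fun x : torus => tnth x j) sl.
suff : (@measurable _ (measurableTypeR R)) `<=`
    image_set_system setT (fun x : torus => tnth x j) (l2set mu real_trig) by apply.
have -> : @measurable _ (measurableTypeR R) = _ := RGenOInfty.measurableE R.
apply: (smallest_sub si).
move=> _ [t ->]; rewrite /image_set_system /= setTI.
have := l2set_tnth_gt j t; congr l2set; apply/seteqP.
by split=> x /=; rewrite in_itv /= andbT.
Qed.

End trigonometric_density.

(** * Integrals of trigonometric functions over the circle and the torus *)

Section circle_integrals.
Local Open Scope complex_scope.
Context {R : realType}.
Notation circ := (@circle_measure R).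

Lemma cos_sin_2piM (n : nat) :
  cos (n%:R * (2 * pi)) = 1 :> R /\ sin (n%:R * (2 * pi)) = 0 :> R.
Proof.
elim: n => [|n [IHc IHs]]; first by rewrite mul0r cos0 sin0.
rewrite -natr1 mulrDl mul1r cosD sinD IHc IHs mulr_natl cos2pi sin2pi.
by rewrite !(mul0r, mulr0, mulr1, subr0, addr0).
Qed.

Lemma cos_sin_2piMz (m : int) :
  cos (m%:~R * (2 * pi)) = 1 :> R /\ sin (m%:~R * (2 * pi)) = 0 :> R.
Proof.
case: m => n; first exact: cos_sin_2piM.
by rewrite NegzE mulrNz mulNr cosN sinN (cos_sin_2piM n.+1).1 (cos_sin_2piM n.+1).2 oppr0.
Qed.

Lemma integrable_bounded_fun d (T : measurableType d) {mu : {finite_measure set T -> \bar R}}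
  (f : T -> R) (M : R) : measurable_fun setT f -> (forall x, `|f x| <= M) ->
  mu.-integrable setT (EFin \o f).
Proof.
move=> mf fM; apply: measurable_bounded_integrable => //.
  by apply: fin_num_fun_lty; exact: fin_num_measure.
exists M; split; first exact: num_real.
by move=> N MN x _; apply: le_trans (fM x) (ltW MN).
Qed.

Lemma integral_circle (f : R -> R) : circ.-integrable setT (EFin \o f) ->
  (\int[circ]_x (f x)%:E = \int[lebesgue_measure]_(x in `[0%R, (2 * pi)%R]) (f x)%:E)%E.
Proof.
move=> fi; have mD : measurable (`[0, 2 * pi] : set (measurableTypeR R)).
  exact: measurable_itv.
rewrite (@negligible_integral _ _ _ circ setT (~` `[0, 2 * pi]))//; first last.
- rewrite -[LHS]/(lebesgue_measure (~` `[0, 2 * pi] `&` `[0, 2 * pi]%classic)).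
  by rewrite setICl measure0.
- exact: measurableC.
rewrite setTD setCK; apply: eq_measure_integral => A mA AD.
by rewrite -[LHS]/(lebesgue_measure (A `&` `[0, 2 * pi]%classic)) setIidl.
Qed.

Lemma Rintegral_circle_deriv (f F : R -> R) : continuous f ->
  (forall x : R, is_derive x 1 F (f x)) -> (exists M : R, forall x, `|f x| <= M) ->
  F 0 = F (2 * pi) -> Rintegral circ setT f = 0.
Proof.
move=> cf dF [M fM] F0.
have mf : measurable_fun setT f by exact: continuous_measurable_fun.
rewrite /Rintegral integral_circle; last first.
  exact: (@integrable_bounded_fun _ (measurableTypeR R) _ _ M).
rewrite (@continuous_FTC2 _ f F).
- by rewrite F0 subee.
- by rewrite mulr_gt0// pi_gt0.
- exact: continuous_subspaceT.
- split.
  + by move=> x _; exact: (dF x).(ex_derive).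
  + apply: cvg_at_right_filter; apply: differentiable_continuous.
    by apply/derivable1_diffP; exact: (dF _).(ex_derive).
  + apply: cvg_at_left_filter; apply: differentiable_continuous.
    by apply/derivable1_diffP; exact: (dF _).(ex_derive).
- by move=> x _; rewrite derive1E; exact: derive_val.
Qed.

Lemma Rintegral_circle_cos (m : int) :
  Rintegral circ setT (fun x => cos (m%:~R * x)) = if m == 0 then 2 * pi else 0.
Proof.
case: eqP => [->|/eqP m0].
  under eq_Rintegral do rewrite mul0r cos0.
  rewrite Rintegral_cst//= mul1r /circle_measure /mrestr setTI.
  rewrite [X in fine X](lebesgue_measure_itv `[0, 2 * pi]) /= lte_fin mulr_gt0 ?pi_gt0//=.
  by rewrite subr0.
have c0 : (m%:~R : R) != 0 by rewrite intr_eq0.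
apply: (@Rintegral_circle_deriv _ (fun x => m%:~R^-1 * sin (m%:~R * x))).
- move=> x; apply: continuous_comp; last exact: continuous_cos.
  exact: mulrl_continuous.
- move=> x.
  have dx : is_derive x 1 ( *%R (m%:~R : R)) m%:~R.
    by apply: is_derive_eq (is_deriveZ m%:~R (is_derive_id x 1)) _; rewrite [LHS]mulr1.
  have := is_deriveZ m%:~R^-1 (is_derive1_comp (is_derive_sin _) dx).
  by move/is_derive_eq; apply; rewrite [LHS]mulrC mulfK.
- by exists 1 => x; rewrite ler_norml cos_geN1 cos_le1.
- by rewrite mulr0 sin0 (cos_sin_2piMz m).2.
Qed.

Lemma Rintegral_circle_sin (m : int) :
  Rintegral circ setT (fun x => sin (m%:~R * x)) = 0.
Proof.
have [->|m0] := eqVneq m 0.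
  by under eq_Rintegral do rewrite mul0r sin0; rewrite Rintegral_cst//= mul0r.
have c0 : (m%:~R : R) != 0 by rewrite intr_eq0.
apply: (@Rintegral_circle_deriv _ (fun x => - m%:~R^-1 * cos (m%:~R * x))).
- move=> x; apply: continuous_comp; last exact: continuous_sin.
  exact: mulrl_continuous.
- move=> x.
  have dx : is_derive x 1 ( *%R (m%:~R : R)) m%:~R.
    by apply: is_derive_eq (is_deriveZ m%:~R (is_derive_id x 1)) _; rewrite [LHS]mulr1.
  have := is_deriveZ (- m%:~R^-1) (is_derive1_comp (is_derive_cos _) dx).
  by move/is_derive_eq; apply; rewrite [LHS]mulrC mulNr mulrNN mulfK.
- by exists 1 => x; rewrite ler_norml sin_geN1 sin_le1.
- by rewrite mulr0 cos0 (cos_sin_2piMz m).1.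
Qed.

End circle_integrals.

Section torus_integrals.
Local Open Scope complex_scope.
Context {R : realType}.

(** Fubini's theorem for a product of functions, after transport along [consm]. The bounds M and N
    provide integrability, the measures being finite. *)
Lemma Rintegral_torusS d (f : d.+1.-tuple (measurableTypeR R) -> R)
  (g : R -> R) (h : d.-tuple (measurableTypeR R) -> R) (M N : R) :
  measurable_fun setT f -> measurable_fun setT g -> measurable_fun setT h ->
  (forall a, `|g a| <= M) -> (forall t, `|h t| <= N) ->
  (forall a t, f (consm (a, t)) = g a * h t) ->
  Rintegral (torus_measure d.+1) setT f =
  Rintegral circle_measure setT g * Rintegral (torus_measure d) setT h.
Proof.
move=> mf mg mh gM hN fgh.
have mEf : measurable_fun setT (EFin \o f) by exact/measurable_EFinP.
have fin : (circle_measure \x torus_measure d)%E.-integrable setT ((EFin \o f) \o @consm R d).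
  apply: (@measurable_bounded_integrable _ _ _ _ (f \o @consm R d)) => //.
  - have /= := product_measure1E circle_measure (torus_measure d)
      (@measurableT _ (measurableTypeR R)) measurableT.
    rewrite setXTT => ->.
    by rewrite ltey_eq fin_numM//; exact: fin_num_measure.
  - by apply: measurableT_comp => //; exact: measurable_consm.
  - exists (M * N); split; first exact: num_real.
    move=> K MK [a t] _ /=; rewrite fgh normrM; apply: le_trans (ltW MK).
    by rewrite ler_pM.
have ig : circle_measure.-integrable setT (EFin \o g).
  exact: (@integrable_bounded_fun _ _ (measurableTypeR R) _ _ M).
have ih : (torus_measure d).-integrable setT (EFin \o h).
  exact: integrable_bounded_fun hN.
rewrite mulrC -RintegralZl//; congr fine.
have -> : (\int[torus_measure d.+1]_x (f x)%:E =
  \int[(circle_measure \x torus_measure d)%E]_z ((EFin \o f) \o @consm R d) z)%E.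
  exact: (@integral_pushforward _ _ _ _ R (@consm R d) (@measurable_consm R d)
    _ setT _ mEf fin measurableT).
rewrite -integral12_prod_meas1//; apply: eq_integral => a _.
transitivity (\int[torus_measure d]_t ((g a)%:E * (EFin \o h) t))%E.
  by apply: eq_integral => t _; rewrite /= fgh EFinM.
rewrite integralZl// mulrC EFinM /Rintegral fineK//.
exact: integrable_fin_num.
Qed.

End torus_integrals.

(** * The Fourier basis *)

Section orthonormality.
Local Open Scope complex_scope.
Local Open Scope quotient_scope.
Context {R : realType}.

Lemma measurable_cos_dotZ d (k : d.-tuple int) :
  measurable_fun setT (fun x : d.-tuple (measurableTypeR R) => cos (dotZ k x)).
Proof.
apply: measurableT_comp (measurable_dotZ k).
by apply: continuous_measurable_fun; exact: continuous_cos.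
Qed.

Lemma measurable_sin_dotZ d (k : d.-tuple int) :
  measurable_fun setT (fun x : d.-tuple (measurableTypeR R) => sin (dotZ k x)).
Proof.
apply: measurableT_comp (measurable_dotZ k).
by apply: continuous_measurable_fun; exact: continuous_sin.
Qed.

Lemma normr_cos_le1 (x : R) : `|cos x| <= 1.
Proof. by rewrite ler_norml cos_geN1 cos_le1. Qed.

Lemma normr_sin_le1 (x : R) : `|sin x| <= 1.
Proof. by rewrite ler_norml sin_geN1 sin_le1. Qed.

(** Both integrals are treated in one induction on d, because the addition formulas for cos and sin
    mix them. Each of the four resulting products factors by Fubini's theorem. *)
Lemma Rintegral_cos_sin_dotZ d (k : d.-tuple int) :
  Rintegral (@torus_measure R d) setT (fun x => cos (dotZ k x)) =
    (if all (pred1 0) k then (2 * pi) ^+ d else 0) /\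
  Rintegral (@torus_measure R d) setT (fun x => sin (dotZ k x)) = 0.
Proof.
elim: d k => [|d IHd] k.
  rewrite (tuple0 k) /=.
  have e x : dotZ ([tuple] : 0.-tuple int) x = 0 :> R by rewrite /dotZ big_ord0.
  under eq_Rintegral do rewrite e cos0.
  under [X in _ /\ X = _]eq_Rintegral do rewrite e sin0.
  split; rewrite Rintegral_cst//; last by rewrite mul0r.
  by rewrite mul1r; transitivity (fine (1%E : \bar R)) => //; congr fine; exact: diracT.
case/tupleP: k => m k; have [IHc IHs] := IHd k.
set mu := torus_measure d.+1.
pose th (x : d.+1.-tuple (measurableTypeR R)) : R := m%:~R * tnth x ord0.
pose tb (x : d.+1.-tuple (measurableTypeR R)) : R := dotZ k [tuple of behead x].
have dE x : dotZ [tuple of m :: k] x = th x + tb x :> R.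
  rewrite /dotZ big_ord_recl; congr (_ + _); apply: eq_bigr => i _.
  rewrite tnthS tnth_behead; congr (_ * tnth x _).
  by apply: val_inj; rewrite [LHS]lift0 [RHS]inordK// ltnS.
have mth : measurable_fun setT th.
  by apply: measurable_funM => //; exact: measurable_tnth.
have mtb : measurable_fun setT tb.
  by apply: measurableT_comp; [exact: measurable_dotZ|exact: measurable_behead].
have mc (f : R -> R) g : continuous f -> measurable_fun setT g ->
    measurable_fun setT (f \o g : d.+1.-tuple (measurableTypeR R) -> R).
  by move=> cf mg; apply: measurableT_comp mg; exact: continuous_measurable_fun.
have mcm (f : R -> R) : continuous f -> measurable_fun setT (fun y : R => f (m%:~R * y)).
  move=> cf; apply: continuous_measurable_fun => y.
  by apply: continuous_comp; [exact: mulrl_continuous|exact: cf].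
have cc : continuous (cos : R -> R) by exact: continuous_cos.
have cs : continuous (sin : R -> R) by exact: continuous_sin.
have prod (f g : R -> R) : continuous f -> continuous g ->
    (forall y, `|f y| <= 1) -> (forall y, `|g y| <= 1) ->
    mu.-integrable setT (EFin \o (fun x => f (th x) * g (tb x))) /\
    Rintegral mu setT (fun x => f (th x) * g (tb x)) =
    Rintegral circle_measure setT (fun y => f (m%:~R * y)) *
    Rintegral (torus_measure d) setT (fun t => g (dotZ k t)).
  move=> cf cg f1 g1.
  have mfg : measurable_fun setT (fun x => f (th x) * g (tb x)).
    by apply: measurable_funM; apply: mc.
  split.
    apply: (integrable_bounded_fun (M := 1 * 1)) => // x.
    by rewrite normrM ler_pM.
  apply: (Rintegral_torusS (M := 1) (N := 1)) => //.
  - exact: mcm.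
  - by apply: measurableT_comp (measurable_dotZ k); exact: continuous_measurable_fun.
  - move=> a t; rewrite /th /tb /= tnth0; congr (_ * g (dotZ k _)).
    exact: val_inj.
have [icc ecc] := prod _ _ cc cc normr_cos_le1 normr_cos_le1.
have [iss ess] := prod _ _ cs cs normr_sin_le1 normr_sin_le1.
have [isc esc] := prod _ _ cs cc normr_sin_le1 normr_cos_le1.
have [ics ecs] := prod _ _ cc cs normr_cos_le1 normr_sin_le1.
split.
  under eq_Rintegral do rewrite dE cosD.
  rewrite RintegralB// ecc ess IHc Rintegral_circle_sin Rintegral_circle_cos.
  rewrite mul0r subr0 /=; case: eqP => _ /=; last by rewrite mul0r.
  by case: ifP => _; rewrite ?mulr0 ?exprS.
under eq_Rintegral do rewrite dE sinD.
by rewrite RintegralD// esc ecs IHs Rintegral_circle_sin mul0r mulr0 addr0.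
Qed.

End orthonormality.

Section fourier_L2.
Local Open Scope complex_scope.
Local Open Scope quotient_scope.
Context {R : realType} {d : nat}.
Notation torus := (d.-tuple (measurableTypeR R)).
Notation mu := (@torus_measure R d).
Notation L2T := (L2 mu).
Implicit Types (k l : d.-tuple int) (f g : L2T) (a : R[i]).

Definition fnorm : R := (2 * pi) `^ (- (d%:R / 2)).

Lemma fnorm_sqr : fnorm ^+ 2 * (2 * pi) ^+ d = 1.
Proof.
have p0 : 0 < 2 * pi :> R by rewrite mulr_gt0// pi_gt0.
rewrite -[X in _ * X]powR_mulrn ?ltW// /fnorm -powR_mulrn ?powR_ge0// -powRrM -powRD.
  by rewrite (_ : _ + _ = 0) ?powRr0//; field.
by rewrite (gt_eqF p0) implybT.
Qed.

Definition oppZ k : d.-tuple int := [tuple - tnth k i | i < d].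

Lemma dotZN k (x : torus) : dotZ (oppZ k) x = - dotZ k x.
Proof.
rewrite /dotZ -sumrN; apply: eq_bigr => i _.
by rewrite tnth_mktuple mulrNz mulNr.
Qed.

Lemma sqr_integrable_exponential k :
  (fun x => fnorm%:C * expi (dotZ k x)) \in L2fun_pred mu.
Proof.
have := sqr_integrable_expi (R := R) (oppZ k).
under eq_fun do rewrite dotZN opprK.
move=> h; have hP : (fun x => expi (dotZ k x)) \in L2fun_pred mu by rewrite inE.
exact: (rpredZ fnorm%:C hP).
Qed.

Definition exponential k : L2T := \pi_(L2T) (MkL2fun (sqr_integrable_exponential k)).

Lemma cintegrable_expi k : cintegrable mu (fun x => expi (dotZ k x)).
Proof.
by split; apply: (integrable_bounded_fun (M := 1)) => [|x]; rewrite /=;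
  [exact: measurable_cos_dotZ|exact: normr_cos_le1|exact: measurable_sin_dotZ
  |exact: normr_sin_le1].
Qed.

Lemma cintegral_expi k : cintegral mu (fun x => expi (dotZ k x)) =
  (if all (pred1 0) k then (2 * pi) ^+ d else 0)%:C.
Proof. by rewrite /cintegral /= !(Rintegral_cos_sin_dotZ k).1 (Rintegral_cos_sin_dotZ k).2. Qed.

Lemma cintegralZ (b : R[i]) (h : torus -> R[i]) : cintegrable mu h ->
  cintegral mu (fun x => b * h x) = b * cintegral mu h.
Proof.
move=> ih; have i0 : cintegrable mu (cst 0 : torus -> R[i]).
  by split; apply: (integrable_bounded_fun (M := 0)) => // x /=; rewrite normr0.
have := cintegral_linear b ih i0; under eq_fun do rewrite addr0.
by move->; rewrite /cintegral !Rintegral_cst//= !mul0r addr0.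
Qed.

Lemma fourier_coef_exponential k l : fourier_coef k (exponential l) = (k == l)%:R.
Proof.
rewrite fourier_coef_pi /fourier_fun /=.
have -> : (fun x : torus => fnorm%:C * expi (dotZ l x) * expi (- dotZ k x)) =
    (fun x => fnorm%:C * expi (dotZ (addZ l (oppZ k)) x)).
  by apply/funext => x; rewrite -mulrA -expiD dotZD dotZN.
rewrite cintegralZ; last exact: cintegrable_expi.
rewrite cintegral_expi.
have -> : all (pred1 0) (addZ l (oppZ k)) = (k == l).
  apply/all_tnthP/eqP => [h|-> i]; last by rewrite /= !tnth_mktuple subrr.
  apply: eq_from_tnth => i; have /= := h i.
  by rewrite !tnth_mktuple subr_eq0 => /eqP.
case: eqP => _; last by rewrite !mulr0.
by rewrite mulrA -!rmorphM /= -expr2 fnorm_sqr.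
Qed.

Lemma L2_norm_sqr_pi (u : L2fun mu) :
  L2_norm (\pi_(L2T) u) ^+ 2 = Rintegral mu setT (fun x => normc (u x) ^+ 2).
Proof.
rewrite L2_norm_pi sqr_sqrtr//; apply: fine_ge0; apply: integral_ge0 => x _.
by rewrite lee_fin sqr_ge0.
Qed.

(** Completing the square around the Fourier coefficient. All later orthogonality statements are
    derived from this identity, which takes the place of an inner product. *)
Lemma L2_norm_sqr_sub a k f :
  L2_norm (f - a *: exponential k) ^+ 2 =
  L2_norm f ^+ 2 - normc (fourier_coef k f) ^+ 2 + normc (fourier_coef k f - a) ^+ 2.
Proof.
set e := MkL2fun (sqr_integrable_exponential k).
set u := repr f; have fu : f = \pi_(L2T) u by rewrite /u reprK.
have -> : f - a *: exponential k = \pi_(L2T) (u - a *: e).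
  rewrite /exponential -/e -[a *: \pi_(L2T) e]/(L2_scale a _) -L2_piZ fu.
  by rewrite -scaleN1r -[- 1 *: _]/(L2_scale _ _) -L2_piZ -L2_piD scaleN1r.
rewrite fu !L2_norm_sqr_pi fourier_coef_pi.
have [mu_ fu_] := L2funP u.
pose phi x := u x * expi (- dotZ k x).
have [ir ii] : cintegrable mu phi.
  by apply: cintegrable_mul; [exact: L2funP|exact: sqr_integrable_expi].
have iu : mu.-integrable setT (EFin \o (fun x => normc (u x) ^+ 2)).
  apply/integrableP; split; first exact: measurable_normc_sqr mu_.
  by under eq_integral do rewrite /= ger0_norm ?sqr_ge0//.
(* The expansion is nested as [Rintegral_linear] expects, whence the factors 1. The last term uses
   cos^2 + sin^2 = 1. *)
have pw x : normc ((u - a *: e) x) ^+ 2 =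
   1 * (1 * normc (u x) ^+ 2 + 1 * (- 2 * fnorm * (cRe a) * cRe (phi x)
      + (- 2 * fnorm * (cIm a)) * cIm (phi x)))
   + (fnorm ^+ 2 * normc a ^+ 2) * 1.
  rewrite L2funBE L2funZE /= !normc_sqr /phi /expi sinN cosN.
  have := cos2Dsin2 (dotZ k x); case: (u x) (a) => [u1 u2] [a1 a2] /= h.
  rewrite -[X in _ = _ + _ * X]h; ring.
under [LHS]eq_Rintegral do rewrite pw.
have [i1 e1] := Rintegral_linear (- 2 * fnorm * cRe a) (- 2 * fnorm * cIm a) ir ii.
have [i2 e2] := Rintegral_linear 1 1 iu i1.
have i3 : mu.-integrable setT (EFin \o (fun _ : torus => 1 : R)).
  exact: finite_measure_integrable_cst.
have [i4 e4] := Rintegral_linear 1 (fnorm ^+ 2 * normc a ^+ 2) i2 i3.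
rewrite e4 e2 e1.
have -> : Rintegral mu setT (fun _ => 1 : R) = (2 * pi) ^+ d.
  have [+ _] := @Rintegral_cos_sin_dotZ R d [tuple 0 | i < d].
  rewrite ifT; last by apply/all_tnthP => i; rewrite tnth_mktuple /=.
  move=> <-; apply: eq_Rintegral => x _.
  by rewrite /dotZ big1 ?cos0// => i _; rewrite tnth_mktuple mul0r.
rewrite [X in _ + X = _]mulrAC fnorm_sqr /fourier_fun -/phi /cintegral.
rewrite !normc_sqr -/fnorm; case: (a) => a1 a2 /=; ring.
Qed.

End fourier_L2.

(** * Finite sums of exponentials and Parseval's inequality *)

Section parseval.
Local Open Scope complex_scope.
Local Open Scope quotient_scope.
Context {R : realType} {d : nat}.
Notation torus := (d.-tuple (measurableTypeR R)).
Notation mu := (@torus_measure R d).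
Notation L2T := (L2 mu).
Notation E := (@exponential R d).
Notation fnrm := (@fnorm R d).
Implicit Types (k l : d.-tuple int) (f g : L2T) (a : R[i]) (s : seq (d.-tuple int))
  (c : d.-tuple int -> R[i]).

Lemma L2_pi0 : \pi_(L2T) (0 : L2fun mu) = 0.
Proof. by apply: (addrI (\pi_(L2T) 0)); rewrite -L2_piD !addr0. Qed.

Lemma fourier_coef0 k : fourier_coef k (0 : L2T) = 0.
Proof.
by have := fourier_coef_linear k (-1) (0 : L2T) 0; rewrite scaler0 addr0 mulN1r addNr.
Qed.

Lemma fourier_coefZ k a f : fourier_coef k (a *: f) = a * fourier_coef k f.
Proof. by rewrite -[a *: f]addr0 fourier_coef_linear fourier_coef0 addr0. Qed.

Lemma fourier_coefD k f g : fourier_coef k (f + g) = fourier_coef k f + fourier_coef k g.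
Proof. by rewrite -[f]scale1r fourier_coef_linear mul1r scale1r. Qed.

Lemma fourier_coefB k f g : fourier_coef k (f - g) = fourier_coef k f - fourier_coef k g.
Proof. by rewrite fourier_coefD -scaleN1r fourier_coefZ mulN1r. Qed.

Lemma fourier_coef_sum k s c : uniq s ->
  fourier_coef k (\sum_(l <- s) c l *: E l) = if k \in s then c k else 0.
Proof.
elim: s => [_|l s IHs /= /andP[ls us]]; first by rewrite big_nil fourier_coef0.
rewrite big_cons fourier_coefD fourier_coefZ fourier_coef_exponential IHs// inE.
case: eqP => [->|_] /=; last by rewrite mulr0 add0r.
by rewrite (negPf ls) mulr1 addr0.
Qed.

(** One frequency is split off at a time: as the list has no repetition, the rest of the sum has
    coefficient 0 there, so subtracting it leaves that coefficient of f unchanged. *)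
Lemma L2_norm_sqr_sub_sum f s c : uniq s ->
  L2_norm (f - \sum_(k <- s) c k *: E k) ^+ 2 = L2_norm f ^+ 2
   - \sum_(k <- s) normc (fourier_coef k f) ^+ 2
   + \sum_(k <- s) normc (fourier_coef k f - c k) ^+ 2.
Proof.
elim: s => [_|l s IHs /= /andP[ls us]]; first by rewrite !big_nil !subr0 addr0.
have cS : fourier_coef l (\sum_(k <- s) c k *: E k) = 0.
  by rewrite fourier_coef_sum// (negPf ls).
rewrite !big_cons.
have -> : f - (c l *: E l + \sum_(k <- s) c k *: E k) =
    f - \sum_(k <- s) c k *: E k - c l *: E l.
  by rewrite opprD addrCA addrC.
rewrite L2_norm_sqr_sub (IHs us) fourier_coefB cS subr0.
set u := normc _ ^+ 2; set v := normc _ ^+ 2.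
set U := \sum_(k <- s) _; set V := \sum_(k <- s) _.
by ring.
Qed.

Lemma L2_norm_sqr_sum s c : uniq s ->
  L2_norm (\sum_(k <- s) c k *: E k) ^+ 2 = \sum_(k <- s) normc (c k) ^+ 2.
Proof.
(* The identity is applied to the sum itself: the left side and the last sum vanish. *)
move=> us; have := L2_norm_sqr_sub_sum (\sum_(k <- s) c k *: E k) c us.
have n0 : L2_norm (0 : L2T) ^+ 2 = 0.
  rewrite -L2_pi0 L2_norm_sqr_pi.
  under eq_Rintegral do rewrite ComplexField.Normc.normc0 expr0n.
  by rewrite Rintegral_cst//= mul0r.
rewrite subrr n0.
rewrite [X in _ + X]big1_seq => [|k /andP[_ ks]]; last first.
  by rewrite fourier_coef_sum// ks subrr ComplexField.Normc.normc0 expr0n.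
rewrite addr0 => /esym/eqP; rewrite subr_eq0 => /eqP ->.
by apply: eq_big_seq => k ks; rewrite fourier_coef_sum// ks.
Qed.

(** Collects repeated frequencies, since the norm identities require a list without repetition. *)
Lemma big_undup_scale (w : seq (R[i] * d.-tuple int)) :
  \sum_(t <- w) t.1 *: E t.2 =
  \sum_(k <- undup (map snd w)) (\sum_(t <- w | t.2 == k) t.1) *: E k.
Proof.
under [RHS]eq_bigr do rewrite scaler_suml big_mkcond.
rewrite exchange_big /=; apply: eq_big_seq => t tw.
rewrite (bigD1_seq t.2) ?undup_uniq//= ?mem_undup ?map_f//.
by rewrite eqxx big1 ?addr0// => k /negPf; rewrite eq_sym => ->.
Qed.

(** [exponential] contains the normalising factor [fnorm]; dividing the coefficients by it recovers
    the plain sum. *)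
Lemma trigsum_L2 (w : seq (R[i] * d.-tuple int)) : exists u : L2fun mu,
  \sum_(t <- w) (t.1 / fnrm%:C) *: E t.2 = \pi_(L2T) u /\ forall x, u x = trigsum w x.
Proof.
have n0 : fnrm%:C != 0.
  rewrite -(rmorph0 (real_complex R)) (inj_eq (@complexI R)).
  by rewrite gt_eqF// powR_gt0// mulr_gt0// pi_gt0.
elim: w => [|t w [u [IHu uE]]].
  by exists 0; rewrite big_nil L2_pi0; split=> // x; rewrite /trigsum big_nil.
exists ((t.1 / fnrm%:C) *: MkL2fun (sqr_integrable_exponential t.2) + u); split.
  by rewrite big_cons L2_piD L2_piZ IHu.
by move=> x; rewrite L2funE uE /= /trigsum big_cons mulrA divfK.
Qed.

(** The real and imaginary parts are approximated separately by real trigonometric polynomials p and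
    q, each with squared error e/2, and p + i q is rewritten over distinct frequencies. *)
Lemma exponential_dense f (e : R) : 0 < e -> exists s c, uniq s /\
  L2_norm (f - \sum_(k <- s) c k *: E k) ^+ 2 <= e.
Proof.
move=> e0; have algP := @bounded_algebra_real_trig R d.
have e2 : 0 < e / 2 by rewrite divr_gt0.
have [mf fi] := L2funP (repr f).
move: (fi); rewrite integral_normc_sqr// => fi'.
have ge0 (h : torus -> R) : (0 <= \int[mu]_x (h x ^+ 2)%:E)%E.
  by apply: integral_ge0 => x _; rewrite lee_fin sqr_ge0.
have fr : (\int[mu]_x (cRe (repr f x) ^+ 2)%:E < +oo)%E.
  by apply: le_lt_trans fi'; rewrite leeDl// (ge0 (fun x => cIm (repr f x))).
have fim : (\int[mu]_x (cIm (repr f x) ^+ 2)%:E < +oo)%E.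
  by apply: le_lt_trans fi'; rewrite leeDr// (ge0 (fun x => cRe (repr f x))).
have [_ /(_ _ e2)[p [mp _ [wp pE]] pe]] := l2cl_full algP (@l2set_torus R d) mf.1 fr.
have [_ /(_ _ e2)[q [mq _ [wq qE]] qe]] := l2cl_full algP (@l2set_torus R d) mf.2 fim.
pose w := wp ++ [seq ('i * t.1, t.2) | t <- wq].
have [u [wu uE]] := trigsum_L2 w.
have ux x : u x = p x +i* q x.
  rewrite uE /trigsum big_cat big_map /= -[X in X + _]/(trigsum wp x) -pE.
  under eq_bigr do rewrite -mulrA; rewrite -mulr_sumr -[X in _ * X]/(trigsum wq x) -qE.
  by simpc.
have := big_undup_scale [seq (t.1 / fnrm%:C, t.2) | t <- w]; rewrite big_map /= wu.
set s := undup _; pose c k := \sum_(t <- [seq (t.1 / fnrm%:C, t.2) | t <- w] | t.2 == k) t.1.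
rewrite -/c => sE; exists s, c; split; first exact: undup_uniq.
rewrite -sE -[f]reprK -scaleN1r -[- 1 *: _]/(L2_scale _ _) -L2_piZ -L2_piD scaleN1r.
rewrite L2_norm_sqr_pi /Rintegral -lee_fin fineK; last first.
  have [_ lt] := L2funP (repr f - u); rewrite ge0_fin_numE; first exact: lt.
  by apply: integral_ge0 => x _; rewrite lee_fin sqr_ge0.
rewrite (splitr e) EFinD; apply: le_trans (leeD pe qe).
rewrite integral_normc_sqr; last exact: (L2funP _).1.
rewrite le_eqVlt; apply/orP; left; apply/eqP; congr (_ + _)%E; apply: eq_integral => x _.
  by rewrite L2funBE ux; case: (repr f x).
by rewrite L2funBE ux; case: (repr f x).
Qed.

Lemma sum_le_esum s (b : d.-tuple int -> R) : uniq s -> (forall k, 0 <= b k) ->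
  ((\sum_(k <- s) b k)%:E <= \esum_(k in [set: d.-tuple int]) (b k)%:E)%E.
Proof.
move=> us b0; apply: ereal_sup_ubound; exists [set` s].
  by split; [exact: finite_seq|].
by rewrite -fsbig_seq// sumEFin.
Qed.

(** For a trigonometric polynomial with squared error at most e, the identity [L2_norm_sqr_sub_sum]
    gives |f|^2 <= sum over s of |c_k(f)|^2 + e after dropping a nonnegative sum. *)
Lemma parseval_le f :
  ((L2_norm f ^+ 2)%:E <= \esum_(k in [set: d.-tuple int]) (normc (fourier_coef k f) ^+ 2)%:E)%E.
Proof.
apply/lee_addgt0Pr => e e0; have [s [c [us]]] := exponential_dense f e0.
rewrite L2_norm_sqr_sub_sum// => le_e.
apply: le_trans (leeD (sum_le_esum us _) (lexx _)); last by move=> k; exact: sqr_ge0.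
rewrite -EFinD lee_fin.
have : 0 <= \sum_(k <- s) normc (fourier_coef k f - c k) ^+ 2.
  by apply: sumr_ge0 => k _; exact: sqr_ge0.
by lra.
Qed.

End parseval.

(** * Bounds for approximation numbers *)

Section approximation_bounds.
Local Open Scope complex_scope.
Local Open Scope quotient_scope.
Context {R : realType} {d : nat} (s : R).
Notation torus := (d.-tuple (measurableTypeR R)).
Notation mu := (@torus_measure R d).
Notation L2T := (L2 mu).
Notation E := (@exponential R d).
Notation H := (Hmix R d s).
Notation appr := (approximation_number (Hmix_norm s) (@L2_norm _ _ R mu)).
Implicit Types (k l : d.-tuple int).

Definition fourier_partial (ks : seq (d.-tuple int)) (f : H) : L2T :=
  \sum_(k <- ks) fourier_coef k (Hmix_val f) *: E k.

Lemma fourier_partial_linear ks : linear (fourier_partial ks).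
Proof.
move=> a f g; rewrite /fourier_partial scaler_sumr -big_split /=.
apply: eq_bigr => k _; rewrite scalerA -scalerDl; congr (_ *: _).
by rewrite -fourier_coef_linear; congr fourier_coef; exact: (linearP (Hmix_embedding d s)).
Qed.

HB.instance Definition _ ks :=
  GRing.isLinear.Build R[i] H L2T *:%R (fourier_partial ks) (fourier_partial_linear ks).

Lemma Hmix_weight_ge1 k : 1 <= Hmix_weight s k.
Proof.
rewrite /Hmix_weight; elim/big_rec: _ => // j y _ y1.
by rewrite mulr_ege1// lerDl powR_ge0.
Qed.

Lemma Hmix_sum_le1 (f : H) : Hmix_norm s f <= 1 -> (Hmix_sum s (Hmix_val f) <= 1)%E.
Proof.
have [f0 ff] : (0 <= Hmix_sum s (Hmix_val f) /\ Hmix_sum s (Hmix_val f) < +oo)%E.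
  split; last by have := valP f; rewrite inE.
  by apply: esum_ge0 => k _; rewrite lee_fin mulr_ge0 ?sqr_ge0 ?Hmix_weight_ge0.
rewrite /Hmix_norm -[X in (_ -> X <= _)%E]fineK ?ge0_fin_numE// lee_fin => h.
by rewrite -[1]sqrtr1 ler_sqrt in h.
Qed.

(** The competitor is the partial Fourier sum over ks, of rank at most the size of ks. Outside ks
    the hypothesis bounds |c_k|^2 by b^2 times its weighted counterpart. *)
Lemma approximation_number_le (n : nat) (ks : seq (d.-tuple int)) (b : R) :
  uniq ks -> (size ks < n)%N -> 0 <= b ->
  (forall k, k \notin ks -> 1 <= b ^+ 2 * Hmix_weight s k) ->
  (appr n (Hmix_embedding d s) <= b%:E)%E.
Proof.
move=> us sn b0 hb.
(* Coefficientwise comparison combined with Parseval's inequality. It is used with C = 1 for the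
   boundedness of the partial sum and with C = b for the error. *)
have norm_le (f : H) (g : L2T) (C : R) : 0 <= C -> Hmix_norm s f <= 1 ->
    (forall k, normc (fourier_coef k g) ^+ 2 <=
      C ^+ 2 * (normc (fourier_coef k (Hmix_val f)) ^+ 2 * Hmix_weight s k)) ->
    L2_norm g <= C.
  move=> C0 f1 fg; rewrite -[L2_norm g]ger0_norm ?sqrtr_ge0// -[C]ger0_norm// -ler_sqr ?nnegrE//.
  rewrite !real_normK ?num_real// -lee_fin.
  apply: le_trans (parseval_le g) _.
  apply: (@le_trans _ _ ((C ^+ 2)%:E * Hmix_sum s (Hmix_val f))%E).
    apply: le_trans (esumZ_le _ _); [|exact: sqr_ge0|].
      by apply: le_esum => k _; rewrite -EFinM lee_fin.
    by move=> k; rewrite lee_fin mulr_ge0 ?sqr_ge0 ?Hmix_weight_ge0.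
  rewrite -[leRHS]mule1 lee_wpmul2l ?lee_fin ?sqr_ge0//; exact: Hmix_sum_le1.
apply: (@le_trans _ _ (op_norm (Hmix_norm s) (@L2_norm _ _ R mu)
    (fun f => Hmix_embedding d s f - fourier_partial ks f))).
  apply: ereal_inf_lbound; exists (fourier_partial ks) => //; split.
    apply: (@le_lt_trans _ _ 1%:E); last exact: ltry.
    apply: ge_ereal_sup => _ [f /= f1 <-]; rewrite lee_fin.
    apply: (norm_le f) => // k; rewrite fourier_coef_sum// expr1n mul1r.
    case: ifPn => _; first by rewrite ler_peMr ?sqr_ge0 ?Hmix_weight_ge1.
    rewrite ComplexField.Normc.normc0 expr0n /=.
    by rewrite mulr_ge0 ?sqr_ge0 ?Hmix_weight_ge0.
  exists (size ks) => //; exists (fun i => E (tnth (in_tuple ks) i)) => f.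
  exists (fun i => fourier_coef (tnth (in_tuple ks) i) (Hmix_val f)).
  by rewrite -[LHS]/(\sum_(k <- ks) _) big_tnth.
apply: ge_ereal_sup => _ [f /= f1 <-]; rewrite lee_fin.
apply: (norm_le f) => // k.
rewrite fourier_coefB fourier_coef_sum//.
case: ifPn => ks_.
  rewrite subrr ComplexField.Normc.normc0 expr0n /=.
  by rewrite !mulr_ge0 ?sqr_ge0 ?Hmix_weight_ge0.
rewrite subr0 mulrCA ler_peMr ?sqr_ge0//; exact: hb.
Qed.

Lemma Hmix_sum_finite (ks : seq (d.-tuple int)) c : uniq ks ->
  Hmix_sum s (\sum_(k <- ks) c k *: E k) =
  (\sum_(k <- ks) normc (c k) ^+ 2 * Hmix_weight s k)%:E.
Proof.
move=> us; rewrite /Hmix_sum.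
transitivity (\esum_(k in [set` ks]) (normc (c k) ^+ 2 * Hmix_weight s k)%:E)%E.
  rewrite [RHS]esum_mkcond; apply: eq_esum => k _; rewrite fourier_coef_sum// mem_setE.
  by case: ifP => // _; rewrite ComplexField.Normc.normc0 expr0n mul0r.
rewrite (esum_fset (finite_seq _)); last first.
  by move=> k _; rewrite lee_fin mulr_ge0 ?sqr_ge0 ?Hmix_weight_ge0.
by rewrite -fsbig_seq// sumEFin.
Qed.

Lemma exponential_Hmix k : E k \in Hmix_pred s.
Proof.
rewrite inE /=; have := @Hmix_sum_finite [:: k] (fun=> 1) isT.
by rewrite !big_seq1 scale1r => ->; rewrite ltry.
Qed.

(** An operator of rank below n vanishes on some nonzero combination F of the n given exponentials.
    Scaled to squared L_2 norm 1/W, F lies in the unit ball of the mixed space, and b^2 <= 1/W. *)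
Lemma approximation_number_ge (n : nat) (kap : 'I_n -> d.-tuple int) (W b : R) :
  injective kap -> 0 < W -> (forall i, Hmix_weight s (kap i) <= W) ->
  0 <= b -> b ^+ 2 * W <= 1 ->
  (b%:E <= appr n (Hmix_embedding d s))%E.
Proof.
move=> kinj W0 kW b0 bW; apply: le_ereal_inf_tmp => _ [A [_ [m mn [y Ay]]] <-].
pose x i : H := MkHmix (exponential_Hmix (kap i)).
have [M AM] : exists M : 'M[R[i]]_(n, m), forall i, A (x i) = \sum_(j < m) M i j *: y j.
  have /choice[c cE] := fun i => Ay (x i).
  by exists (\matrix_(i, j) c i j) => i; rewrite cE; apply: eq_bigr => j _; rewrite mxE.
(* M has n rows and only m < n columns, so its left kernel is nonzero. *)
have [v v0 vM] : exists2 v : 'rV[R[i]]_n, v != 0 & v *m M = 0.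
  have : kermx M != 0.
    rewrite -mxrank_eq0 mxrank_ker subn_eq0 -ltnNge.
    by apply: leq_ltn_trans mn; exact: rank_leq_col.
  case/rowV0Pn => v /sub_kermxP vM v0; by exists v.
pose ks := [seq kap i | i <- enum 'I_n].
have us : uniq ks by rewrite map_inj_uniq// enum_uniq.
pose S2 : R := \sum_(i < n) normc (v 0 i) ^+ 2.
have S20 : 0 < S2.
  have [i vi] : exists i, v 0 i != 0 by apply/rV0Pn.
  rewrite /S2 (bigD1 i)//= ltr_pwDl ?sumr_ge0//.
    rewrite lt_neqAle sqr_ge0 andbT eq_sym sqrf_eq0.
    apply: contra vi => /eqP/ComplexField.Normc.eq0_normc ->.
    exact: eqxx.
  by move=> j _; exact: sqr_ge0.
pose t : R := Num.sqrt (W * S2)^-1.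
have t2 : t ^+ 2 * (W * S2) = 1.
  by rewrite sqr_sqrtr ?invr_ge0 ?mulVf ?gt_eqF ?mulr_gt0// ltW// mulr_gt0.
pose F : H := t%:C *: \sum_(i < n) v 0 i *: x i.
(* The coefficients, reindexed by frequency; since [kap] is injective the sum has at most one
   term. *)
pose c k := \sum_(i < n | kap i == k) t%:C * v 0 i.
have cE i : c (kap i) = t%:C * v 0 i.
  by rewrite /c (eq_bigl (pred1 i)) ?big_pred1_eq// => j; rewrite /= inj_eq.
have FE : Hmix_embedding d s F = \sum_(k <- ks) c k *: E k.
  rewrite /F linearZ_LR linear_sum scaler_sumr /ks big_map big_enum /=.
  by apply: eq_bigr => i _; rewrite cE scalerA.
have AF : A F = 0.
  rewrite /F linearZ_LR linear_sum.
  have -> : \sum_(i < n) A (v 0 i *: x i) = \sum_(j < m) (v *m M) 0 j *: y j.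
    under eq_bigr do rewrite linearZ_LR AM scaler_sumr.
    rewrite exchange_big /=; apply: eq_bigr => j _.
    rewrite mxE scaler_suml; apply: eq_bigr => i _; by rewrite scalerA.
  by rewrite vM big1 ?scaler0// => j _; rewrite mxE scale0r.
have nc i : normc (c (kap i)) ^+ 2 = t ^+ 2 * normc (v 0 i) ^+ 2.
  rewrite cE ComplexField.Normc.normcM exprMn; congr (_ * _).
  by rewrite normc_sqr /= expr0n addr0.
apply: (@le_trans _ _ (L2_norm (Hmix_embedding d s F - A F))%:E); last first.
  apply: ereal_sup_ubound; exists F => //=.
  rewrite /Hmix_norm -[Hmix_val F]/(Hmix_embedding d s F) FE Hmix_sum_finite//=.
  rewrite -sqrtr1 ler_wsqrtr// -t2 /ks big_map big_enum /= /S2 mulr_sumr mulr_sumr.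
  apply: ler_sum => i _; rewrite nc -mulrA ler_wpM2l ?sqr_ge0// mulrC.
  by rewrite ler_wpM2r ?sqr_ge0.
rewrite AF subr0 FE lee_fin -ler_sqr ?nnegrE ?sqrtr_ge0//.
rewrite L2_norm_sqr_sum// /ks big_map big_enum /=.
under eq_bigr do rewrite nc.
rewrite -mulr_sumr -/S2 -(ler_pM2r W0) -[X in _ <= X]mulrA [S2 * W]mulrC t2.
exact: bW.
Qed.

End approximation_bounds.

(** * Counting frequencies *)

Section hyperbolic_cross_count.
Local Open Scope nat_scope.

(** Counts the points constructed in [cross_points], a lower bound for the number of k in Z^d with
    prod_j (1 + |k_j|) <= 2^u. In the recursion the first coordinate is 0, or arises by one of two
    maps from that of a point for u - 1. *)
Fixpoint cross_count (d u : nat) : nat :=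
  match d with
  | 0 => 1
  | d'.+1 => (fix cross_count_d u := match u with
      | 0 => 1
      | u'.+1 => cross_count d' u'.+1 + 2 * cross_count_d u'
      end) u
  end.

Lemma cross_countSS d u :
  cross_count d.+1 u.+1 = cross_count d u.+1 + 2 * cross_count d.+1 u.
Proof. by []. Qed.

(* The two maps are injective, with disjoint images covering the nonzero integers:
   0 -> {1, -1}, a -> {2a + 1, 2a} for a > 0, a -> {2a - 1, 2a} for a < 0. *)
Definition double_odd (a : int) : int := (if 0 <= a then 2 * a + 1 else 2 * a - 1)%R.
Definition double_even (a : int) : int := (if a == 0 then -1 else 2 * a)%R.

Definition maphead (h : int -> int) d (k : d.+1.-tuple int) : d.+1.-tuple int :=
  [tuple of h (thead k) :: behead k].

Lemma maphead_inj (h : int -> int) d : injective h -> injective (@maphead h d).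
Proof.
move=> hi k l /(congr1 val) /= [/hi hkl bkl]; rewrite (tuple_eta k) (tuple_eta l).
by apply: val_inj; rewrite /= hkl bkl.
Qed.

(** [double_odd] and [double_even] send a to integers b with 1 + |b| <= 2 (1 + |a|), so applying
    either to the first coordinate at most doubles the product. *)
Lemma cross_points d u : exists s : seq (d.-tuple int), [/\ uniq s, size s = cross_count d u &
  forall k, k \in s -> \prod_(j < d) (1 + `|tnth k j|) <= 2 ^ u].
Proof.
elim: d u => [|d IHd] u.
  exists [:: [tuple]]; split=> // k _; by rewrite big_ord0 expn_gt0.
elim: u => [|u [s2 [us2 ss2 ps2]]].
  exists [:: [tuple 0%R | i < d.+1]]; split=> // k.
  by rewrite inE => /eqP ->; rewrite big1// => i _; rewrite tnth_mktuple.
have [s1 [us1 ss1 ps1]] := IHd u.+1.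
have prodE (k : d.+1.-tuple int) : \prod_(j < d.+1) (1 + `|tnth k j|) =
    (1 + `|thead k|) * \prod_(j < d) (1 + `|tnth [tuple of behead k] j|).
  rewrite big_ord_recl; congr (_ * _); apply: eq_bigr => j _.
  by rewrite {1}(tuple_eta k) tnthS.
pose c0 (k : d.-tuple int) : d.+1.-tuple int := [tuple of 0%R :: k].
have c0i : injective c0 by move=> k l /(congr1 val) /= [] /val_inj.
have oi : injective double_odd.
  by move=> a b; rewrite /double_odd; do 2!case: ifP => ?; lia.
have ei : injective double_even.
  by move=> a b; rewrite /double_even; do 2!case: eqP => ?; lia.
exists (map c0 s1 ++ map (@maphead double_odd d) s2 ++ map (@maphead double_even d) s2).
have th (h : int -> int) k : thead (@maphead h d k) = h (thead k) by [].
have bh (h : int -> int) k : [tuple of behead (@maphead h d k)] = [tuple of behead k].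
  exact: val_inj.
split.
- rewrite !cat_uniq !map_inj_uniq ?us1 ?us2//; try exact: maphead_inj.
  rewrite /= andbT; apply/andP; split.
    apply/hasPn => k; rewrite mem_cat => /orP[] /mapP[l _ ->]; apply/negP => /mapP[m _];
      move/(congr1 (@thead _ _)); rewrite th theadE /double_odd /double_even; case: ifP => ?; lia.
  apply/hasPn => k /mapP[l _ ->]; apply/negP => /mapP[m _].
  by move/(congr1 (@thead _ _)); rewrite !th /double_odd /double_even; do 2!case: ifP => ?; lia.
- by rewrite !size_cat !size_map ss1 ss2 addnn -mul2n.
- have dbl (h : int -> int) k : (forall a, (1 + `|h a|)%N <= 2 * (1 + `|a|)) -> k \in s2 ->
      \prod_(j < d.+1) (1 + `|tnth (maphead h k) j|) <= 2 ^ u.+1.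
    move=> hh /ps2; rewrite !prodE th bh => le_u; rewrite expnS.
    apply: leq_trans (leq_mul (hh _) (leqnn _)) _.
    by rewrite -mulnA leq_mul2l /=.
  move=> k; rewrite !mem_cat => /or3P[] /mapP[l ls ->].
  + rewrite prodE theadE mul1n -[X in _ <= X]muln1 muln1.
    by rewrite (_ : [tuple of behead (c0 l)] = l); [exact: ps1|exact: val_inj].
  + by apply: dbl => // a; rewrite /double_odd; case: ifP => ?; lia.
  + by apply: dbl => // a; rewrite /double_even; case: ifP => ?; lia.
Qed.

(** Multiplied by 2^u, Pascal's rule becomes the recursion of [cross_count]. *)
Lemma cross_count_bin d u : 2 ^ u * 'C(u + d, u) <= cross_count d.+1 u.
Proof.
elim: d u => [|d IHd]; elim=> [|u IHu]; rewrite ?bin0 ?expn0//.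
  rewrite cross_countSS addn0 binn muln1 expnS.
  by move: IHu; rewrite addn0 binn muln1 /=; lia.
rewrite cross_countSS (_ : u.+1 + d.+1 = (u.+1 + d).+1); last by lia.
rewrite binS mulnDr leq_add//.
rewrite expnS -mulnA leq_mul2l /=.
by rewrite (_ : u.+1 + d = u + d.+1) ?IHu//; lia.
Qed.

Lemma cross_count1 d : cross_count d 1 = 2 * d + 1.
Proof. by elim: d => // d IHd; rewrite cross_countSS IHd (_ : cross_count d.+1 0 = 1)//; lia. Qed.

Lemma prod_rising d u : \prod_(i < u) (d.+1 + i) = 'C(u + d, u) * u`!.
Proof.
rewrite bin_ffact ffact_prod (reindex_inj rev_ord_inj) /=; apply: eq_bigr => i _.
have := ltn_ord i; lia.
Qed.

Lemma prod_sqr_rev u (f : nat -> nat) :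
  (\prod_(i < u) f i) ^ 2 = \prod_(i < u) (f i * f (u - i.+1)).
Proof.
by rewrite big_split /= -mulnn; congr (_ * _); exact: (reindex_inj rev_ord_inj).
Qed.

(* Jensen's inequality for the convex function log (1 + d / i): in the square of
   the product, the factors i + 1 and u - i are paired and compared by AM-GM. *)
Lemma bin_rising_ge d u : u + d.+1 <= u * d ->
  (u + d.+1) ^ u <= u ^ u * 'C(u + d, u).
Proof.
move=> ud; rewrite -(leq_pmul2r (fact_gt0 u)) -mulnA -prod_rising.
have -> : u`! = \prod_(i < u) i.+1 by rewrite fact_prod big_add1 big_mkord.
have cst c : c ^ u = \prod_(i < u) c by rewrite prod_nat_const card_ord.
rewrite !cst -!big_split -leq_sqr /=.
rewrite (prod_sqr_rev u (fun i => (u + d.+1) * i.+1)).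
rewrite (prod_sqr_rev u (fun i => u * (d.+1 + i))).
apply: leq_prod => i _; have iu := ltn_ord i.
have [j uij] : exists j, u = i + j.+1 by exists (u - i.+1); lia.
have -> : u - i.+1 = j by lia.
have P4 : 4 * (i.+1 * j.+1) <= u.+1 ^ 2.
  by rewrite (_ : u.+1 = i.+1 + j.+1); [exact: (nat_AGM2 _ _).1|lia].
(* The hypothesis, rewritten. With P = (i + 1)(j + 1) the claim for one pair is (d + 1)(2u + d + 1)
   P <= u^2 d (d + u + 1), which follows from 4 P <= (u + 1)^2 and two uses of this bound. *)
have ab : d.+1 * u.+1 <= 2 * (d * u) by lia.
have h1 := leq_mul P4 (leqnn (d.+1 * (2 * u + d.+1))).
have h2 := leq_mul ab ab.
have h3 := leq_mul ab (leqnn (2 * (u * u.+1))).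
have e : (d.+1 + i) * (d.+1 + j) = d * d + d * u.+1 + i.+1 * j.+1.
  rewrite (_ : u.+1 = i.+1 + j.+1); lia.
rewrite mulnACA [X in _ <= X]mulnACA e -(@leq_pmul2l 4)//.
move: (i.+1 * j.+1) h1 h2 h3 => P; rewrite -!mulnn => h1 h2 h3.
lia.
Qed.

(** Two applications of Pascal's rule at least triple the binomial coefficient, while the left side
    grows by the factor 2 (d + 3) / (d + 2) <= 3. *)
Lemma central_bin_ge d : d.+2 * 2 ^ d.+2 <= 4 * 'C(d.+2.*2, d.+1).
Proof.
elim: d => // d; have := mul_bin_left d.+2.*2 d.+1.
rewrite (_ : d.+2.*2 - d.+1 = d.+3) ?[d.+3.*2]doubleS ?[2 ^ d.+3]expnS; last by lia.
move: (d.+2.*2) (2 ^ d.+2) => N t; rewrite !binS.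
set a := 'C(N, d.+1); set b := 'C(N, d.+2); set c := 'C(N, d) => ab IH.
have {}ab : a <= b by rewrite -(@leq_pmul2l d.+2)// ab leq_mul2r leqnSn orbT.
lia.
Qed.

(** The binomial bound combined with [bin_rising_ge]. The condition of the latter fails only for u =
    1, where [cross_count] equals 2 d + 1, and for u = 2 in dimensions 2 and 3, which are
    computed. *)
Lemma cross_count_ge_small d u n : 2 <= d -> 0 < u <= d ->
  n * u ^ u < (2 * (u + d)) ^ u -> n <= cross_count d u.
Proof.
case: d => // d d2; case/andP => u0 ud.
have [->|u1] := eqVneq u 1; first by rewrite cross_count1 !expn1; lia.
have [ok|nok] := leqP (u + d.+1) (u * d).
  move=> nu; rewrite -(@leq_pmul2r (u ^ u)) ?expn_gt0 ?u0//.
  apply: leq_trans (ltnW nu) _; rewrite expnMn.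
  apply: leq_trans (leq_mul (leqnn _) (bin_rising_ge ok)) _.
  rewrite mulnCA mulnC leq_mul2r; apply/orP; right; exact: cross_count_bin.
have : (u == 2) && ((d == 1) || (d == 2)) by nia.
case/andP => /eqP -> /orP[] /eqP -> /=; lia.
Qed.

(** By monotonicity the binomial bound is smallest at u = d + 1, where [central_bin_ge] applies. *)
Lemma cross_count_ge_large d u n : 2 <= d -> d < u ->
  2 * n <= d * 4 ^ d -> n <= cross_count d u.
Proof.
case: d => // -[//|d] _ du nd; apply: leq_trans (cross_count_bin _ _).
rewrite -(@leq_pmul2l 2)//; apply: leq_trans nd _.
have -> : 'C(u + d.+1, u) = 'C(u + d.+1, d.+1).
  by rewrite -bin_sub ?leq_addr// addnC addnK.
have h1 : 2 ^ d.+3 <= 2 ^ u by rewrite leq_exp2l.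
have h2 : 'C(d.+2.*2, d.+1) <= 'C(u + d.+1, d.+1) by apply: leq_bin2l; lia.
apply: (@leq_trans (2 * (2 ^ d.+3 * 'C(d.+2.*2, d.+1)))); last first.
  by rewrite leq_mul2l leq_mul.
have := leq_mul (leqnn (2 ^ d.+2)) (central_bin_ge d).
rewrite (_ : 4 ^ d.+2 = 2 ^ d.+2 * 2 ^ d.+2); last by rewrite -expnMn.
by rewrite [2 ^ d.+3]expnS; lia.
Qed.

End hyperbolic_cross_count.

(** * Comparison of the weight with powers of integer products *)

Section powR_one_plus.
Context {R : realType}.
Implicit Types (x q : R).

(** The weights t = 1 / (1 + x) and t = x / (1 + x) lie in (0, 1), where t <= t^q for q <= 1 and t^q
    <= t for q >= 1; each of the next two lemmas compares both summands this way. *)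
Lemma powR_split x q : 0 < x ->
  (1 + x) `^ q = (1 + x)^-1 * (1 + x) `^ q + x / (1 + x) * (1 + x) `^ q.
Proof. by move=> x0; set y := _ `^ q; field; rewrite gt_eqF//; lra. Qed.

Lemma powR_one_plus_le x q : 0 <= x -> 0 < q <= 1 -> (1 + x) `^ q <= 1 + x `^ q.
Proof.
rewrite le_eqVlt => /orP[/eqP <-|x0] /andP[q0 q1]; first by rewrite addr0 powR1 lerDl powR_ge0.
have S0 : 0 < 1 + x by lra.
rewrite powR_split//; apply: lerD.
  rewrite [leRHS](_ : 1 = ((1 + x)^-1 * (1 + x)) `^ q); last first.
    by rewrite mulVf ?powR1// gt_eqF.
  rewrite powRM ?invr_ge0 ?(ltW S0)//.
  rewrite ler_pM2r ?powR_gt0//; apply: ger1_powR => //.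
  by rewrite invr_gt0 S0 /= invf_le1//; lra.
rewrite -[x in leRHS](divfK (lt0r_neq0 S0)) [leRHS]powRM ?divr_ge0 ?(ltW S0) ?(ltW x0)//.
rewrite ler_pM2r ?powR_gt0//; apply: ger1_powR => //.
by rewrite divr_gt0//= ler_pdivrMr//; lra.
Qed.

Lemma powR_one_plus_ge x q : 0 <= x -> 1 <= q -> 1 + x `^ q <= (1 + x) `^ q.
Proof.
rewrite le_eqVlt => /orP[/eqP <-|x0] q1.
  by rewrite addr0 powR1 powR0 ?addr0// gt_eqF//; lra.
have S0 : 0 < 1 + x by lra.
rewrite powR_split//; apply: lerD.
  rewrite [leLHS](_ : 1 = ((1 + x)^-1 * (1 + x)) `^ q); last first.
    by rewrite mulVf ?powR1// gt_eqF.
  apply: ge1r_powRZ => //; last exact: ltW.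
  by rewrite invr_gt0 S0 /= invf_le1//; lra.
rewrite -[x in leLHS](divfK (lt0r_neq0 S0)).
apply: ge1r_powRZ => //; last exact: ltW.
by rewrite divr_gt0//= ler_pdivrMr//; lra.
Qed.

Lemma powR_prod (I : finType) (F : I -> R) q : (forall i, 0 <= F i) ->
  (\prod_i F i) `^ q = \prod_i F i `^ q.
Proof.
move=> F0; suff [] : 0 <= \prod_i F i /\ (\prod_i F i) `^ q = \prod_i F i `^ q by [].
elim/big_rec2: _ => [|i y z _ [z0 <-]]; first by rewrite powR1.
by rewrite mulr_ge0// powRM.
Qed.

End powR_one_plus.

Section weight_bounds.
Context {R : realType} {d : nat} (s : R).
Implicit Types k : d.-tuple int.

Lemma Hmix_weight_ge k : 0 < s <= 1 ->
  ((\prod_(j < d) (1 + `|tnth k j| ^ 2))%N%:R) `^ s <= Hmix_weight s k.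
Proof.
move=> s01; rewrite natr_prod powR_prod//; apply: ler_prod => j _.
rewrite powR_ge0 /= natrD natrX.
apply: le_trans (powR_one_plus_le _ s01) _; first exact: sqr_ge0.
by rewrite lerD2l -powR_mulrn// -powRrM.
Qed.

Lemma Hmix_weight_le k : 1 / 2 <= s ->
  Hmix_weight s k <= ((\prod_(j < d) (1 + `|tnth k j|))%N%:R) `^ (2 * s).
Proof.
move=> s2; rewrite natr_prod powR_prod//; apply: ler_prod => j _.
rewrite addr_ge0 ?powR_ge0//= natrD.
by apply: powR_one_plus_ge => //; lra.
Qed.

End weight_bounds.

(** * Rankin's bound for the number of k with prod_j (1 + k_j^2) < r *)

Section rankin.
Context {R : realType} (d : nat) (p : R).
Hypotheses (d0 : (0 < d)%N) (p2 : 2 <= p) (pd : 2 `^ p = 4 * d%:R).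

Definition rankin_term (m : nat) : R := (1 + m ^ 2)%N%:R `^ (- p).

(* 1 + m^2 >= 2m, and m^p >= m^2. *)
Lemma rankin_term_le m : rankin_term m.+1 <= (4 * d%:R * m.+1%:R ^+ 2)^-1.
Proof.
rewrite /rankin_term powRN lef_pV2 ?posrE ?powR_gt0 ?mulr_gt0 ?exprn_gt0 ?ltr0n//.
rewrite -pd -[_ ^+ 2]powR_mulrn//.
have h : 2 * m.+1%:R <= (1 + m.+1 ^ 2)%N%:R :> R by rewrite -natrM ler_nat; lia.
apply: (@le_trans _ _ ((2 * m.+1%:R) `^ p)).
  rewrite powRM// ler_wpM2l ?powR_ge0//; apply: ler_powR => //.
  by rewrite ler1n.
by apply: ge0_ler_powR => //; rewrite ?nnegrE ?mulr_ge0// (le_trans _ p2).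
Qed.

(** The index a - M runs through the integers from -M to M. The summand with 1 / (2 M + 1) sharpens
    the bound 1 + 1/d just enough for an induction on M. *)
Lemma rankin_sum_le M :
  \sum_(a < (2 * M).+1) rankin_term `|a%:Z - M%:Z| <= 1 + d%:R^-1 * (1 - (2 * M).+1%:R^-1).
Proof.
have dR : 0 < d%:R :> R by rewrite ltr0n.
elim: M => [|M IHM].
  rewrite big_ord1 /rankin_term /= invr1 subrr mulr0 addr0.
  by rewrite [(_ + _)%N]/= powR1.
rewrite (_ : (2 * M.+1).+1 = (2 * M).+3); last by lia.
have -> : \sum_(a < (2 * M).+3) rankin_term `|a%:Z - M.+1%:Z| =
    rankin_term M.+1 + \sum_(a < (2 * M).+1) rankin_term `|a%:Z - M%:Z| + rankin_term M.+1.
  rewrite big_ord_recr big_ord_recl; congr (_ + _ + _).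
  - by congr rankin_term => /=; lia.
  - by apply: eq_bigr => i _; congr rankin_term => /=; rewrite /bump /=; lia.
  - by congr rankin_term => /=; lia.
have := rankin_term_le M.
set P := rankin_term _; set S := \sum_(_ < _) _ => hP.
have {}IHM : S <= 1 + d%:R^-1 * (1 - (2 * M).+1%:R^-1) by exact: IHM.
(* 1 / m^2 <= 1 / (m - 1/2) - 1 / (m + 1/2), so that the sum telescopes *)
suff : 2 * (4 * d%:R * M.+1%:R ^+ 2)^-1 <=
    d%:R^-1 * ((2 * M).+1%:R^-1 - (2 * M).+3%:R^-1) :> R.
  move: hP IHM.
  move: (_ ^-1) (d%:R^-1) ((2 * M).+1%:R^-1) ((2 * M).+3%:R^-1) => A D y z; rewrite !mulrBr; lra.
have -> : (2 * M).+1%:R = 2 * M.+1%:R - 1 :> R by rewrite -!natr1 natrM; ring.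
have -> : (2 * M).+3%:R = 2 * M.+1%:R + 1 :> R by rewrite -!natr1 natrM; ring.
set m : R := M.+1%:R; have m1 : 1 <= m by rewrite ler1n.
have -> : (2 * m - 1)^-1 - (2 * m + 1)^-1 = 2 / (4 * m ^+ 2 - 1).
  by field; rewrite !gt_eqF//=; nra.
rewrite -[4 * _ * _]mulrA [4 * _]mulrCA invfM mulrCA ler_pM2l ?invr_gt0//.
rewrite ler_pM2l// lef_pV2 ?posrE; nra.
Qed.

Lemma absz_shift (a : int) (M : nat) : (`|a| < M)%N ->
  (absz (a + M%:Z)%R)%:Z - M%:Z = a /\ (absz (a + M%:Z)%R < (2 * M).+1)%N.
Proof. by move=> aM; split; lia. Qed.

(** Each counted point contributes 1 <= (r / W)^p, where W = prod_j (1 + k_j^2). Summed over a cube,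
    W^(-p) factors into the d-th power of a one-dimensional sum, at most (1 + 1/d)^d <= e. *)
Lemma quadratic_cross_count (r : R) : 0 < r -> exists ks : seq (d.-tuple int),
  [/\ uniq ks, forall k, (k \in ks) = ((\prod_(j < d) (1 + `|tnth k j| ^ 2))%N%:R < r)
   & (size ks)%:R <= expR 1 * r `^ p].
Proof.
move=> r0; have dR : 0 < d%:R :> R by rewrite ltr0n.
(* M exceeds r, and k_j^2 < r forces |k_j| < M, so the cube [-M, M]^d contains all the points. *)
pose M := (Num.trunc r).+1.
pose W k := (\prod_(j < d) (1 + `|tnth k j| ^ 2))%N.
pose kap (f : {ffun 'I_d -> 'I_(2 * M).+1}) : d.-tuple int := [tuple (f i)%:Z - M%:Z | i < d].
have kapI : injective kap.
  move=> f g fg; apply/ffunP => i; apply: val_inj => /=.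
  by have := congr1 (fun k => tnth k i) fg; rewrite !tnth_mktuple; lia.
pose ks := [seq kap f | f <- enum [pred f | (W (kap f))%:R < r]].
exists ks; split.
- by rewrite map_inj_uniq// enum_uniq.
- move=> k; apply/mapP/idP => [[f + ->]|kr]; first by rewrite mem_enum.
  have kM j : (`|tnth k j| < M)%N.
    have : (`|tnth k j| ^ 2)%N%:R < r.
      apply: le_lt_trans kr; rewrite ler_nat (bigD1 j)//=.
      apply: leq_trans (leq_pmulr _ _); first by lia.
      by apply: prodn_gt0 => i; lia.
    have := truncnS_gt r; rewrite -/M => rM /lt_trans/(_ rM); rewrite ltr_nat.
    by nia.
  have e : kap [ffun j => inord (absz (tnth k j + M%:Z)%R)] = k.
    apply: eq_from_tnth => j; have [h1 h2] := absz_shift (kM j).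
    by rewrite tnth_mktuple ffunE inordK.
  exists [ffun j => inord (absz (tnth k j + M%:Z)%R)]; last by rewrite e.
  by rewrite mem_enum inE /= e.
rewrite size_map -cardE -sum1_card natr_sum.
apply: (@le_trans _ _ (\sum_(f : {ffun 'I_d -> 'I_(2 * M).+1})
  r `^ p * \prod_i rankin_term `|(f i)%:Z - M%:Z|)).
  have t0 (f : {ffun 'I_d -> 'I_(2 * M).+1}) : 0 <= r `^ p * \prod_i rankin_term `|(f i)%:Z - M%:Z|.
    by rewrite mulr_ge0 ?powR_ge0// prodr_ge0// => i _; exact: powR_ge0.
  rewrite [leRHS](bigID [pred f | (W (kap f))%:R < r]) /= -[leLHS]addr0 lerD ?sumr_ge0//.
  apply: ler_sum => f; rewrite inE => fr.
  rewrite -powR_prod// -natr_prod.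
  have -> : (\prod_(i < d) (1 + `|(f i)%:Z - M%:Z| ^ 2))%N = W (kap f).
    by apply: eq_bigr => i _; rewrite tnth_mktuple.
  have W0 : 0 < (W (kap f))%:R :> R by rewrite ltr0n prodn_gt0// => i; lia.
  rewrite powRN ler_pdivlMr ?powR_gt0// mul1r.
  by apply: ge0_ler_powR; rewrite ?nnegrE ?(le_trans _ p2)// ltW.
(* Distributivity: the sum over all functions of a product becomes a product of sums. *)
rewrite -mulr_sumr -(bigA_distr_bigA (fun (_ : 'I_d) (j : 'I_(2 * M).+1) =>
  rankin_term `|j%:Z - M%:Z|)) mulrC ler_wpM2r ?powR_ge0//.
rewrite prodr_const card_ord.
apply: (@le_trans _ _ ((1 + d%:R^-1) ^+ d)).
  apply: lerXn2r; rewrite ?nnegrE.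
  - by apply: sumr_ge0 => i _; exact: powR_ge0.
  - by rewrite addr_ge0// invr_ge0 ltW.
  apply: (le_trans (rankin_sum_le M)).
  by rewrite lerD2l ler_piMr ?invr_ge0// lerBlDr lerDl invr_ge0.
apply: (@le_trans _ _ (expR d%:R^-1 ^+ d)).
  by rewrite lerXn2r ?nnegrE ?expR_ge0 ?expR_ge1Dx// addr_ge0// invr_ge0 ltW.
by rewrite -expRM_natl mulfV// gt_eqF.
Qed.

End rankin.

(** * The two estimates *)

Section log2.
Context {R : realType}.
Implicit Types x y : R.

Lemma ln2_gt0 : 0 < ln 2 :> R.
Proof. by rewrite ln_gt0// ltr1n. Qed.

Lemma powR_log2 y : 0 < y -> 2 `^ (log2 y) = y.
Proof.
by move=> y0; rewrite /powR gt_eqF// /log2 divfK ?lnK// gt_eqF ?ln2_gt0.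
Qed.

Lemma powR2_mono x y : (2 `^ x < 2 `^ y) = (x < y).
Proof.
by rewrite /powR !gt_eqF// ltr_expR ltr_pM2r// ln2_gt0.
Qed.

Lemma powR2_le x y : (2 `^ x <= 2 `^ y) = (x <= y).
Proof. by rewrite leNgt powR2_mono -leNgt. Qed.

Lemma powRK x y : 0 < x -> y != 0 -> (x `^ y^-1) `^ y = x.
Proof. by move=> x0 y0; rewrite -powRrM mulVf// powRr1// ltW. Qed.

End log2.

(** The exponent 4 + log_2(d^2) is 2 p with p = 2 + log_2 d, and 2^p = 4 d is the relation under
    which the count above holds. *)
Lemma approximation_number_Hmix_le (R : realType) (d : nat) (s : R) (n : nat) :
  (0 < d)%N -> 0 < s <= 1 -> (0 < n)%N ->
  (approximation_number (Hmix_norm s) (@L2_norm _ _ R (torus_measure d)) n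
      (Hmix_embedding d s)
    <= ((expR 1 ^+ 2 / n%:R) `^ (s / (4 + log2 (d%:R ^+ 2))))%:E)%E.
Proof.
move=> d0 s01 n0; have [s0 s1] := andP s01.
have dR : 1 <= d%:R :> R by rewrite ler1n.
have nR : 0 < n%:R :> R by rewrite ltr0n.
pose p : R := 2 + log2 d%:R.
have p2 : 2 <= p by rewrite lerDl divr_ge0 ?ln_ge0 ?ler1n.
have p0 : 0 < p by lra.
have pd : 2 `^ p = 4 * d%:R.
  rewrite powRD; last by rewrite pnatr_eq0 implybT.
  by rewrite powR_log2 ?powR_mulrn//; [rewrite -natrX|lra].
have -> : 4 + log2 (d%:R ^+ 2) = 2 * p :> R.
  by rewrite /p /log2 lnXn ?ltr0n// mulr2n; field; rewrite gt_eqF// ln2_gt0.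
set q : R := expR 1 ^+ 2 / n%:R.
have q0 : 0 < q by rewrite divr_gt0// exprn_gt0// expR_gt0.
(* Then r^p = n / e^2, so at most e r^p = n / e < n frequencies are kept, and the error bound b =
   q^(s / (2 p)) satisfies b^2 r^s = 1. *)
pose r : R := q^-1 `^ p^-1.
have r0 : 0 < r by rewrite powR_gt0// invr_gt0.
have [ks [uks ksE sks]] := quadratic_cross_count d0 p2 pd r0.
apply: approximation_number_le (uks) _ (powR_ge0 _ _) _.
  rewrite -(ltr_nat R); apply: le_lt_trans sks _.
  rewrite /r powRK ?invr_gt0 ?gt_eqF// /q invf_div mulrCA.
  rewrite gtr_pMr// expr2 invfM mulrA divff ?mul1r ?gt_eqF ?expR_gt0//.
  by rewrite invf_lt1 ?expR_gt0// expR_gt1.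
move=> k; rewrite ksE -leNgt => rk.
apply: (@le_trans _ _ ((q `^ (s / (2 * p))) ^+ 2 * r `^ s)).
  rewrite -powR_mulrn ?powR_ge0// -powRrM /r -powRrM -(powR_inv1 (ltW q0)) -powRrM.
  rewrite -powRD; last by rewrite (gt_eqF q0) implybT.
  rewrite (_ : _ + _ = 0) ?powRr0//.
  by field; rewrite gt_eqF.
rewrite ler_wpM2l ?sqr_ge0//; apply: le_trans (Hmix_weight_ge k s01).
by apply: ge0_ler_powR; rewrite ?nnegrE ?(ltW r0) ?(ltW s0).
Qed.

Section lower_bound.
Context {R : realType} (d n : nat).
Hypotheses (d2 : (2 <= d)%N) (n2 : (2 <= n)%N).

Let L : R := log2 n%:R.

Let L1 : 1 <= L.
Proof.
rewrite -powR2_le powR_log2 ?ltr0n; last exact: ltnW.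
by rewrite powRr1// ler_nat.
Qed.

Let L0 : 0 < L. Proof. exact: lt_le_trans L1. Qed.

Let powR2_L : 2 `^ L = n%:R. Proof. by rewrite powR_log2// ltr0n ltnW. Qed.

(** This identity explains the form of alpha: the right side is the base 2 + 2 d / u of the count,
    evaluated at u = L / 2. *)
Let powR2_alpha : 2 `^ (alpha n d) = 2 + 4 * d%:R / L :> R.
Proof.
have dL : 0 <= d%:R / L by rewrite divr_ge0// ltW.
rewrite /alpha powRD; last by rewrite pnatr_eq0 implybT.
rewrite powR_log2 -/L ?powR_mulrn//; last by rewrite ltr_wpDl.
by field; rewrite gt_eqF.
Qed.

Lemma alpha_gt1 : 1 < alpha n d :> R.
Proof.
rewrite -powR2_mono powR2_alpha powRr1// ltrDl divr_gt0//.
by rewrite mulr_gt0// ltr0n ltnW.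
Qed.

(** For u <= d it suffices that n < (2 + 2 d / u)^u. Otherwise n >= 4^u, hence u <= L / 2 and n >=
    (2 + 4 d / L)^u, which contradicts L < u alpha. *)
Lemma cross_count_ge u : n%:R <= d%:R / 2 * 4 ^+ d :> R ->
  L / alpha n d < u%:R -> (n <= cross_count d u)%N.
Proof.
move=> hn xu; have a0 : 0 < alpha n d :> R by apply: lt_trans alpha_gt1.
have u0 : (0 < u)%N by rewrite -(ltr_nat R); apply: lt_trans xu; rewrite divr_gt0.
have uR : 0 < u%:R :> R by rewrite ltr0n.
have [ud|du] := leqP u d; last first.
  apply: cross_count_ge_large => //; rewrite -(ler_nat R) !natrM natrX.
  by move: hn; set t := 4 ^+ d; lra.
apply: cross_count_ge_small; rewrite ?u0//.
rewrite -(ltr_nat R) natrM !natrX natrM natrD.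
rewrite -ltr_pdivlMr ?exprn_gt0// -expr_div_n.
have -> : 2 * (u%:R + d%:R) / u%:R = 2 + 2 * d%:R / u%:R :> R.
  by field; rewrite gt_eqF.
rewrite ltNge; apply/negP => nge.
(* The base 2 + 2 d / u is at least 4 because u <= d. *)
have Lu : 2 * u%:R <= L.
  rewrite -powR2_le powR2_L powRrM powR_mulrn ?powR_ge0//; apply: le_trans nge.
  rewrite powR_mulrn//; apply: lerXn2r; rewrite ?nnegrE//.
  have : 2 <= 2 * d%:R / u%:R :> R.
    by rewrite ler_pdivlMr// ler_pM2l// ler_nat.
  by rewrite expr2; lra.
have : n%:R < (2 + 4 * d%:R / L) ^+ u :> R.
  rewrite -powR2_L -powR2_alpha -powR_mulrn ?powR_ge0// -powRrM powR2_mono.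
  by rewrite mulrC -ltr_pdivrMr.
apply/negP; rewrite -leNgt; apply: le_trans nge; apply: lerXn2r; rewrite ?nnegrE.
- by apply: addr_ge0 => //; apply: divr_ge0 (ltW L0); rewrite mulr_ge0.
- by rewrite addr_ge0// divr_ge0// mulr_ge0.
rewrite lerD2l ler_pdivrMr// mulrAC ler_pdivlMr//.
rewrite (_ : 4 * d%:R * u%:R = 2 * d%:R * (2 * u%:R)); last by ring.
by rewrite ler_wpM2l ?mulr_ge0.
Qed.

Lemma approximation_number_Hmix_ge (s : R) : 1 / 2 <= s ->
  n%:R <= d%:R / 2 * 4 ^+ d :> R ->
  ((2 `^ (- s) * (1 / n%:R) `^ (s / alpha n d))%:E
     <= approximation_number (Hmix_norm s) (@L2_norm _ _ R (torus_measure d)) n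
          (Hmix_embedding d s))%E.
Proof.
move=> s2 hn; have a0 : 0 < alpha n d :> R by apply: lt_trans alpha_gt1.
have nR : 0 < n%:R :> R by rewrite ltr0n ltnW.
pose x : R := L / alpha n d.
have x0 : 0 <= 1 + x by rewrite addr_ge0// divr_ge0// ltW.
(* The upper inequality gives u > x, hence enough frequencies; the lower one gives 2^u <= 2
   n^(1/alpha). This rounding is the source of the factor 2^(-s). *)
have [u /andP[ux xu]] : exists u : nat, u%:R <= 1 + x < u.+1%:R.
  by exists (Num.trunc (1 + x)); exact: truncn_itv.
have [ks [uks sks pks]] := cross_points d u.
have nks : (n <= size ks)%N.
  by rewrite sks cross_count_ge//; move: xu; rewrite -natr1 -/x; lra.
pose Y : R := 2 * n%:R `^ (alpha n d)^-1.
have Y0 : 0 < Y by rewrite mulr_gt0// powR_gt0.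
have uY : 2 ^+ u <= Y.
  rewrite -powR_mulrn// /Y -powR2_L -powRrM -[X in _ <= X * _](powRr1 (ltW _))//.
  rewrite -powRD; last by rewrite pnatr_eq0 implybT.
  by rewrite powR2_le.
have -> : 2 `^ (- s) * (1 / n%:R) `^ (s / alpha n d) = Y `^ (- s).
  rewrite /Y powRM ?powR_ge0//; congr (_ * _).
  rewrite div1r -(powR_inv1 (ltW nR)) -!powRrM; congr powR.
  by field; rewrite gt_eqF.
(* The first n points of the list are used, so the default of [nth] is never reached. Their weights
   are at most Y^(2 s), and b = Y^(-s). *)
apply: (@approximation_number_ge _ _ _ _ (fun i => nth [tuple 0 | i < d] ks i) (Y `^ (2 * s))).
- move=> i j /eqP; rewrite nth_uniq//; last 2 first.
  + exact: leq_trans (ltn_ord i) nks.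
  + exact: leq_trans (ltn_ord j) nks.
  by move=> /eqP/val_inj.
- exact: powR_gt0.
- move=> i; apply: le_trans (Hmix_weight_le _ s2) _.
  have s20 : 0 <= 2 * s by lra.
  apply: (ge0_ler_powR s20); rewrite ?nnegrE ?ler0n ?(ltW Y0) //.
  apply: le_trans uY; rewrite -natrX ler_nat; apply: pks.
  by apply: mem_nth; exact: leq_trans (ltn_ord i) nks.
- exact: powR_ge0.
- rewrite -powR_mulrn ?powR_ge0// -powRrM -powRD; last by rewrite (gt_eqF Y0) implybT.
  by rewrite (_ : _ + _ = 0) ?powRr0//; ring.
Qed.

End lower_bound.

Theorem theorem4p19 (R : realType) (d : nat) (s : R) (n : nat)
  (hd : (2 <= d)%N) (hs0 : 1 / 2 <= s) (hs1 : s <= 1)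
  (hn2 : (2 <= n)%N) (hn : n%:R <= d%:R / 2 * 4 ^+ d :> R) :
  ((2 `^ (- s) * (1 / n%:R) `^ (s / alpha n d))%:E
     <= approximation_number (Hmix_norm s) (@L2_norm _ _ R (torus_measure d)) n
          (Hmix_embedding d s)
     <= ((expR 1 ^+ 2 / n%:R) `^ (s / (4 + log2 (d%:R ^+ 2))))%:E)%E.
Proof.
apply/andP; split; first exact: approximation_number_Hmix_ge.
apply: approximation_number_Hmix_le; [exact: ltnW| |exact: ltnW].
by rewrite hs1 andbT; lra.
Qed.
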